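(* There exists an AF C$^*$-algebra $\mathfrak{A}$ such that $\mathfrak{A}_{+} \cap \overline{Nil(\mathfrak{A})} \neq \{0\}$.
   Context: $\mathfrak{A}_+$ is the set of positive elements of $\mathfrak{A}$; $Nil(\mathfrak{A})$ is the set of nilpotent elements of $\mathfrak{A}$; the closure is in the norm topology. An AF C$^*$-algebra is the norm closure of the union of an increasing sequence of finite dimensional C$^*$-subalgebras. *)

(* Defs.v *)
From HB Require Import structures.
From mathcomp Require Import all_boot all_order all_algebra.
From mathcomp Require Import complex.
From mathcomp Require Import all_classical all_reals all_analysis.

Set Implicit Arguments.
Unset Strict Implicit.
Unset Printing Implicit Defensive.

Import Order.TTheory GRing.Theory Num.Theory.
Import numFieldNormedType.Exports.

Local Open Scope classical_set_scope.
Local Open Scope ring_scope.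
Local Open Scope complex_scope.

(* C*-algebras are complex and need not have an identity; hence they cannot be
   based on the (unital) ring structures of ssralg.  The norm takes its values
   in the nonnegative elements of R[i]. *)
HB.mixin Record CompleteNormedModule_isCstarAlgebra (R : realType) A
    of CompleteNormedModule R[i] A := {
  cmul : A -> A -> A ;
  cstar : A -> A ;
  cmulA : associative cmul ;
  cmulDl : left_distributive cmul +%R ;
  cmulDr : right_distributive cmul +%R ;
  cmulZl : forall (k : R[i]) (x y : A), cmul (k *: x) y = k *: cmul x y ;
  cmulZr : forall (k : R[i]) (x y : A), cmul x (k *: y) = k *: cmul x y ;
  cstarK : involutive cstar ;
  cstarD : {morph cstar : x y / x + y} ;
  cstarZ : forall (k : R[i]) (x : A), cstar (k *: x) = (k^*)%R *: cstar x ;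
  cstarM : forall x y : A, cstar (cmul x y) = cmul (cstar y) (cstar x) ;
  cnormM : forall x y : A, `|cmul x y| <= `|x| * `|y| ;
  cnorm_star : forall x : A, `|cmul (cstar x) x| = `|x| ^+ 2
}.

#[short(type="cstarAlgType")]
HB.structure Definition CstarAlgebra (R : realType) :=
  {A of CompleteNormedModule R[i] A & CompleteNormedModule_isCstarAlgebra R A}.

Declare Scope cstar_scope.
Notation "x ** y" := (cmul x y) (at level 40, left associativity) : cstar_scope.
Local Open Scope cstar_scope.

Section CstarDefs.
Context {R : realType} {A : cstarAlgType R}.
Implicit Types (a b e : A) (B : set A) (l : R[i]).

Definition is_identity e := forall a, e ** a = a /\ a ** e = a.

(* (a, l) stands for a + l 1 in the unitization of A *)
Definition unitization_mul (x y : A * R[i]) : A * R[i] :=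
  (x.1 ** y.1 + x.2 *: y.1 + y.2 *: x.1, x.2 * y.2).

(* The spectrum is taken in A if A has an identity, and in the unitization of A
   otherwise. *)
Definition spectrum a : set R[i] := [set l |
  (forall e, is_identity e ->
     ~ exists b, (l *: e - a) ** b = e /\ b ** (l *: e - a) = e) /\
  ((~ exists e, is_identity e) ->
     ~ exists y, unitization_mul (- a, l) y = (0, 1) /\
                 unitization_mul y (- a, l) = (0, 1))].

Definition selfadjoint a := cstar a = a.

(* In the order of R[i], 0 <= l means that l is real and nonnegative. *)
Definition positive : set A :=
  [set a | selfadjoint a /\ spectrum a `<=` [set l | 0 <= l]].

(* iter n (cmul a) a is the power a^(n+1) *)
Definition nilpotents : set A := [set a | exists n, iter n (cmul a) a = 0].

Definition cstar_subalgebra B :=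
  [/\ B 0,
      forall (k : R[i]) a b, B a -> B b -> B (k *: a + b),
      forall a b, B a -> B b -> B (a ** b),
      forall a, B a -> B (cstar a) &
      closed B].

Definition finite_dimensional B := exists (n : nat) (v : 'I_n -> A),
  B = [set \sum_(i < n) c i *: v i | c in [set: 'I_n -> R[i]]].

End CstarDefs.

Arguments positive {R} A.
Arguments nilpotents {R} A.

Definition is_AF {R : realType} (A : cstarAlgType R) :=
  exists B : nat -> set A,
    [/\ forall n, cstar_subalgebra (B n) /\ finite_dimensional (B n),
        forall n, B n `<=` B n.+1 &
        closure (\bigcup_n B n) = [set: A]].

(* Main.v *)
Require Import Defs.
From HB Require Import structures.
From mathcomp Require Import all_boot all_order all_algebra.
From mathcomp Require Import finmap generic_quotient ring_quotient complex.
From mathcomp Require Import all_classical all_reals all_analysis.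
From mathcomp Require Import ring lra zify.
Set Implicit Arguments.
Unset Strict Implicit.
Unset Printing Implicit Defensive.
Import Order.TTheory GRing.Theory Num.Theory.
Import numFieldNormedType.Exports.
Local Open Scope classical_set_scope.
Local Open Scope ring_scope.
Local Open Scope complex_scope.
Local Open Scope quotient_scope.
Import Normc.

(** The algebra is generated by matrix units on the space V of finitely
supported functions of a finite set w of real numbers.  For t >= 0 and finite
sets S, S', the operator munit t S S' acts on the part of w in the window
]0, t] only: it replaces the configuration S' there by S and kills the vectors
that carry another configuration.  A product of two such operators is zero or
again of this form, with the larger window.  Hence those whose data lie in a
finite grid span a finite-dimensional *-algebra, and the closure A of the union
over the grids j / 4^k is an AF algebra (completion_AF).

The projections emptyp t = munit t fset0 fset0 onto the functions carried by the w
without a point in ]0, t] decrease with t.  The averages stair k of these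
projections over the 4^k grid points are diagonal, with an eigenvalue at w that
is within 4^-k of the first point of w in ]0, 1], or of 1 if there is none
(height_first_point).  They converge to an element a of A, which has norm at least 1 because every stair k fixes the
basis vector of the empty set, and which is positive because the resolvents of
stair k, again functions of the same projections, converge too
(resolvent_cauchy, positive_cls).

Now replace emptyp t by nilpart t, which acts on the coordinate [t in w] by the
matrix with rows (1, -1) and (1, -1), of square zero, and still projects onto
the empty configuration before t.  A sum of these over increasing points t is
triangular, hence nilpotent (sum_nilpart_nilpotent).  On the other hand, over
L = 4^k points the two sums differ by a projection plus pstar X - X, where X is
the sum of the operators insertp t that add the point t.  The ranges of the
latter are orthogonal, so pstar X * X is the sum of the projections emptyp t,
and the C*-identity gives |X|^2 <= L.  After division by L the distance is at
most (1 + 2 sqrt L) / L <= 3 / 2^k (stair_nilstair), and a is a limit of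
nilpotents.  A bounded trace vanishes at nilpotents, and no faithful one exists
here: for s < t the projection emptyp s dominates infinitely many orthogonal
projections munit t S S, with S in ]s, t], all equivalent to emptyp t.

The C*-algebra itself is obtained in two steps.  Bounded adjointable operators
on a pre-Hilbert space satisfy the C*-identity (opnorm_starM), and the Cauchy
sequences in a *-subalgebra S, modulo null sequences, form a C*-algebra in which
S is dense.  Subalgebras of finite dimension stay closed in it because a
finite-dimensional subspace of a complex normed space is closed (closed_span). *)

(** * Algebras with a C*-seminorm *)

(** The axioms of a unital C*-algebra other than definiteness and completeness:
pnorm may vanish at nonzero elements, which become zero in the completion. *)
HB.mixin Record isPreCstar (R : realType) D
    of GRing.Algebra R[i] D := {
  pstar : D -> D ;
  pnorm : D -> R ;
  pstarK : involutive pstar ;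
  pstarD : {morph pstar : x y / x + y} ;
  pstarZ : forall (k : R[i]) (x : D), pstar (k *: x) = (k^*)%R *: pstar x ;
  pstarM : forall x y : D, pstar (x * y) = pstar y * pstar x ;
  ler_pnormD : forall x y : D, pnorm (x + y) <= pnorm x + pnorm y ;
  pnormZ : forall (k : R[i]) (x : D), pnorm (k *: x) = normc k * pnorm x ;
  ler_pnormM : forall x y : D, pnorm (x * y) <= pnorm x * pnorm y ;
  pnorm_pstarM : forall x : D, pnorm (pstar x * x) = pnorm x ^+ 2
}.

#[short(type="preCstarType")]
HB.structure Definition PreCstar (R : realType) :=
  {D of GRing.Algebra R[i] D & isPreCstar R D}.

Lemma normc_ge0 (R : realType) (z : R[i]) : 0 <= normc z.
Proof. by case: z => a b /=; rewrite sqrtr_ge0. Qed.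

Section Seminorm.
Context {R : realType} {D : preCstarType R}.
Implicit Types x y : D.

Lemma pstar0 : pstar 0 = 0 :> D.
Proof. by apply: (addrI (pstar 0)); rewrite -pstarD !addr0. Qed.

Lemma pstarN x : pstar (- x) = - pstar x.
Proof. by apply: (addrI (pstar x)); rewrite -pstarD !subrr pstar0. Qed.

Lemma pstarB x y : pstar (x - y) = pstar x - pstar y.
Proof. by rewrite pstarD pstarN. Qed.

Lemma pstar_sum (I : Type) (r : seq I) (P : pred I) (F : I -> D) :
  pstar (\sum_(i <- r | P i) F i) = \sum_(i <- r | P i) pstar (F i).
Proof. by apply: (big_morph _ pstarD pstar0). Qed.

Lemma pnorm0 : pnorm (0 : D) = 0.
Proof. by rewrite -(scale0r (0 : D)) pnormZ normc0 mul0r. Qed.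

Lemma pnormN x : pnorm (- x) = pnorm x.
Proof.
by rewrite -scaleN1r pnormZ /= oppr0 expr0n/= addr0 sqrrN expr1n sqrtr1 mul1r.
Qed.

Lemma pnormBC x y : pnorm (x - y) = pnorm (y - x).
Proof. by rewrite -pnormN opprB. Qed.

Lemma pnorm_ge0 x : 0 <= pnorm x.
Proof.
have : 0 <= pnorm x + pnorm x.
  by rewrite -pnorm0 -(subrr x) (le_trans (ler_pnormD _ _))// pnormN.
by rewrite -mulr2n pmulrn_lge0.
Qed.

Lemma ler_pnormB x y : pnorm (x - y) <= pnorm x + pnorm y.
Proof. by rewrite -(pnormN y) ler_pnormD. Qed.

Lemma ler_dist_pnorm x y : `|pnorm x - pnorm y| <= pnorm (x - y).
Proof.
have key (u v : D) : pnorm u - pnorm v <= pnorm (u - v).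
  by rewrite lerBlDr -{1}(subrK v u) ler_pnormD.
by rewrite ler_norml key andbT lerNl opprB pnormBC key.
Qed.

(** The C*-identity and submultiplicativity give |x|^2 <= |pstar x| |x|. *)
Lemma pnorm_pstar x : pnorm (pstar x) = pnorm x.
Proof.
have key (u : D) : pnorm u <= pnorm (pstar u).
  have [u0|u0] := eqVneq (pnorm u) 0; first by rewrite u0 pnorm_ge0.
  have {}u0 : 0 < pnorm u by rewrite lt_def u0 pnorm_ge0.
  by rewrite -(ler_pM2r u0) -expr2 -pnorm_pstarM ler_pnormM.
by apply/eqP; rewrite eq_le key -{2}(pstarK x) key.
Qed.

Lemma ler_pnorm_sum (I : Type) (r : seq I) (P : pred I) (F : I -> D) :
  pnorm (\sum_(i <- r | P i) F i) <= \sum_(i <- r | P i) pnorm (F i).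
Proof.
elim/big_rec2 : _ => [|i y1 y2 _ h]; first by rewrite pnorm0.
by rewrite (le_trans (ler_pnormD _ _))// lerD2l.
Qed.

(** For a self-adjoint idempotent x the C*-identity reads |x| = |x|^2. *)
Lemma pnorm_projection x : pstar x = x -> x * x = x -> pnorm x <= 1.
Proof.
move=> ax xx; have := pnorm_pstarM x; rewrite ax xx => h.
have [->|x0] := eqVneq (pnorm x) 0; first exact: ler01.
have {}x0 : 0 < pnorm x by rewrite lt_def x0 pnorm_ge0.
by rewrite -(ler_pM2l x0) -expr2 -h mulr1.
Qed.

End Seminorm.

(** * Cauchy sequences *)

Section RealSequences.
Context {R : realType}.

Lemma cauchy_cvg_real (u : R^nat) :
  (forall e, 0 < e -> exists N, forall m n, (N <= m)%N -> (N <= n)%N ->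
     `|u m - u n| < e) -> cvgn u.
Proof.
move=> uc; apply/cauchy_cvgP; apply: cauchy_exP => e e0.
have [N hN] := uc _ e0; exists (u N); exists N => // n /= Nn.
by rewrite /ball/= hN.
Qed.

Lemma ler_limn (u v : R^nat) (l l' : R) : u n @[n --> \oo] --> l ->
  v n @[n --> \oo] --> l' -> (forall n, u n <= v n) -> l <= l'.
Proof.
move=> ul vl uv; rewrite -(cvg_lim (@Rhausdorff R) ul).
rewrite -(cvg_lim (@Rhausdorff R) vl).
by apply: ler_lim; [apply/cvg_ex; exists l|apply/cvg_ex; exists l'|near=> n].
Unshelve. all: by end_near. Qed.

Lemma gt0_complexP (e : R[i]) : 0 < e -> exists2 r : R, 0 < r & e = r%:C.
Proof.
case: e => a b; rewrite ltcE /= => /andP[/eqP b0 a0].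
by exists a => //; rewrite b0.
Qed.

Lemma natSinv_lt (e : R) : 0 < e ->
  exists N, forall n, (N <= n)%N -> n.+1%:R^-1 < e.
Proof.
by move=> e0; have [N _ hN] := near_infty_natSinv_lt (PosNum e0); exists N.
Qed.

End RealSequences.

Section CauchySequences.
Context {R : realType} {D : preCstarType R}.

Definition pcauchy (x : nat -> D) := forall e : R, 0 < e -> exists N,
  forall m n, (N <= m)%N -> (N <= n)%N -> pnorm (x m - x n) < e.

Lemma pcauchy_cst (d : D) : pcauchy (fun=> d).
Proof. by move=> e e0; exists 0%N => m n _ _; rewrite subrr pnorm0. Qed.

Lemma pcauchy_cvg_pnorm x : pcauchy x -> cvgn (fun n => pnorm (x n)).
Proof.
move=> xc; apply: cauchy_cvg_real => e /xc[N hN]; exists N => m n Nm Nn.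
by rewrite (le_lt_trans (ler_dist_pnorm _ _))// hN.
Qed.

Lemma pcauchy_bounded x : pcauchy x -> exists2 M : R, 0 < M &
  forall n, pnorm (x n) <= M.
Proof.
move=> /pcauchy_cvg_pnorm/cvg_seq_bounded[M [Mr hM]].
exists (`|M| + 1); first by rewrite ltr_wpDl.
move=> n; rewrite -[pnorm _]ger0_norm ?pnorm_ge0//.
by apply: hM => //; rewrite ltr_pwDr// ler_norm.
Qed.

Lemma pcauchyZD (k : R[i]) x y : pcauchy x -> pcauchy y -> pcauchy (k *: x + y).
Proof.
move=> xc yc e e0.
(* adding 1 makes the division below legitimate for k = 0 *)
have k0 : 0 < normc k + 1.
  by rewrite ltr_wpDl// normc_ge0.
have [N1 h1] := xc (e / 2 / (normc k + 1)) (divr_gt0 (divr_gt0 e0 (ltr0Sn R 1)) k0).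
have [N2 h2] := yc (e / 2) (divr_gt0 e0 (ltr0Sn R 1)).
exists (maxn N1 N2) => m n; rewrite !geq_max => /andP[m1 m2] /andP[n1 n2].
rewrite (_ : (k *: x + y) m - (k *: x + y) n =
    k *: (x m - x n) + (y m - y n)); last first.
  rewrite -[LHS]/(k *: x m + y m - (k *: x n + y n)).
  by rewrite opprD addrACA scalerBr.
rewrite (le_lt_trans (ler_pnormD _ _))// [e]splitr.
rewrite ler_ltD// ?h2// pnormZ.
rewrite (@le_trans _ _ ((normc k + 1) * pnorm (x m - x n)))//.
  by rewrite ler_wpM2r ?pnorm_ge0// lerDl.
by rewrite mulrC -ler_pdivlMr// ltW// h1.
Qed.

Lemma pcauchyM x y : pcauchy x -> pcauchy y -> pcauchy (fun n => x n * y n).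
Proof.
move=> xc yc e e0.
have [M1 M10 hM1] := pcauchy_bounded xc.
have [M2 M20 hM2] := pcauchy_bounded yc.
have [N1 h1] := xc (e / 2 / M2) (divr_gt0 (divr_gt0 e0 (ltr0Sn R 1)) M20).
have [N2 h2] := yc (e / 2 / M1) (divr_gt0 (divr_gt0 e0 (ltr0Sn R 1)) M10).
exists (maxn N1 N2) => m n; rewrite !geq_max => /andP[m1 m2] /andP[n1 n2].
rewrite (_ : _ - _ = (x m - x n) * y m + x n * (y m - y n)); last first.
  by rewrite mulrBl mulrBr addrA subrK.
rewrite (le_lt_trans (ler_pnormD _ _))// [e]splitr ltrD//.
  rewrite (le_lt_trans (ler_pnormM _ _))//.
  rewrite (@le_lt_trans _ _ (pnorm (x m - x n) * M2))//.
    by rewrite ler_wpM2l ?pnorm_ge0.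
  by rewrite -ltr_pdivlMr// h1.
rewrite (le_lt_trans (ler_pnormM _ _))//.
rewrite (@le_lt_trans _ _ (M1 * pnorm (y m - y n)))//.
  by rewrite ler_wpM2r ?pnorm_ge0.
by rewrite mulrC -ltr_pdivlMr// h2.
Qed.

Lemma pcauchy_pstar x : pcauchy x -> pcauchy (fun n => pstar (x n)).
Proof.
move=> xc e /xc[N h]; exists N => m n Nm Nn.
by rewrite -pstarB pnorm_pstar h.
Qed.

Definition pnull (x : nat -> D) := pnorm (x n) @[n --> \oo] --> (0 : R).

Lemma pnull_le (x : nat -> D) (f : R^nat) :
  (forall n, pnorm (x n) <= f n) -> f n @[n --> \oo] --> 0 -> pnull x.
Proof.
move=> xf f0; apply: squeeze_cvgr (cvg_cst (0 : R)) f0.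
by near=> n; rewrite pnorm_ge0 xf.
Unshelve. all: by end_near. Qed.

Lemma pnullD x y : pnull x -> pnull y -> pnull (x + y).
Proof.
move=> x0 y0.
apply: (@pnull_le _ (fun n => pnorm (x n) + pnorm (y n))).
  by move=> n; exact: ler_pnormD.
by rewrite -[0]addr0; exact: cvgD.
Qed.

Lemma pnullZ (k : R[i]) x : pnull x -> pnull (k *: x).
Proof.
move=> x0.
apply: (@pnull_le _ (fun n => normc k * pnorm (x n))).
  by move=> n; rewrite pnormZ.
by rewrite -(mulr0 (normc k)); apply: cvgM => //; exact: cvg_cst.
Qed.

Lemma pnullMl x y : pcauchy x -> pnull y -> pnull (fun n => x n * y n).
Proof.
move=> /pcauchy_bounded[M M0 hM] y0.
apply: (@pnull_le _ (fun n => M * pnorm (y n))).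
  by move=> n; rewrite (le_trans (ler_pnormM _ _))// ler_wpM2r// pnorm_ge0.
by rewrite -(mulr0 M); apply: cvgM => //; exact: cvg_cst.
Qed.

Lemma pnullMr x y : pnull x -> pcauchy y -> pnull (fun n => x n * y n).
Proof.
move=> x0 /pcauchy_bounded[M M0 hM].
apply: (@pnull_le _ (fun n => pnorm (x n) * M)).
  by move=> n; rewrite (le_trans (ler_pnormM _ _))// ler_wpM2l// pnorm_ge0.
by rewrite -(mul0r M); apply: cvgM => //; exact: cvg_cst.
Qed.

Lemma pnull_pstar x : pnull x -> pnull (fun n => pstar (x n)).
Proof. by move=> x0; apply: (pnull_le _ x0) => n; rewrite pnorm_pstar. Qed.

End CauchySequences.

(** * Completion of a *-subalgebra *)

Section StarSubalgebra.
Context {R : realType} {D : preCstarType R}.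

Record is_starsub (S : set D) : Prop := IsStarsub {
  starsub0 : S 0 ;
  starsubZD : forall (k : R[i]) a b, S a -> S b -> S (k *: a + b) ;
  starsubM : forall a b, S a -> S b -> S (a * b) ;
  starsub_star : forall a, S a -> S (pstar a) }.

(** Bundled so that the predicate cauchy_in below can carry its canonical
closure properties. *)
Record starsub := Starsub {
  carrier : set D ;
  starsubP : is_starsub carrier }.

End StarSubalgebra.
Arguments starsub {R} D.

Section Completion.
Context {R : realType} {D : preCstarType R} (S : starsub D).

(** Requiring the terms to lie in S makes the quotient by null sequences the
closure of S in the completion of D. *)
Definition cauchy_in : {pred nat -> D} :=
  fun x => `[< (forall n, carrier S (x n)) /\ pcauchy x >].

Lemma cauchy_in_submod : submod_closed cauchy_in.
Proof.
split; first by apply/asboolP; split=> [n|];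
  [exact: starsub0 (starsubP S)|exact: pcauchy_cst].
move=> k x y /asboolP[Sx xc] /asboolP[Sy yc]; apply/asboolP; split.
  by move=> n; apply: (starsubZD (starsubP S)).
exact: pcauchyZD.
Qed.

HB.instance Definition _ := GRing.isSubmodClosed.Build _ _ cauchy_in
  cauchy_in_submod.

Record cseq := CSeq { cseq_val :> nat -> D ; cseqP : cseq_val \in cauchy_in }.

HB.instance Definition _ := [isSub for cseq_val].
HB.instance Definition _ := [Choice of cseq by <:].
HB.instance Definition _ := [SubChoice_isSubLmodule of cseq by <:].

Lemma cseq_in (x : cseq) n : carrier S (x n).
Proof. by have /asboolP[] := cseqP x. Qed.

Lemma cseq_cauchy (x : cseq) : pcauchy x.
Proof. by have /asboolP[] := cseqP x. Qed.

Lemma cseqM_subproof (x y : cseq) : (fun n => x n * y n) \in cauchy_in.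
Proof.
apply/asboolP; split; last by apply: pcauchyM; exact: cseq_cauchy.
by move=> n; apply: (starsubM (starsubP S)); exact: cseq_in.
Qed.

Lemma cseq_star_subproof (x : cseq) : (fun n => pstar (x n)) \in cauchy_in.
Proof.
apply/asboolP; split; last by apply: pcauchy_pstar; exact: cseq_cauchy.
by move=> n; apply: (starsub_star (starsubP S)); exact: cseq_in.
Qed.

Definition cseqM x y := CSeq (cseqM_subproof x y).
Definition cseq_star x := CSeq (cseq_star_subproof x).

Definition null_cseq : {pred cseq} := fun x => `[< pnull x >].

Lemma null_cseq_zmod : zmod_closed null_cseq.
Proof.
split; first by apply/asboolP/(@pnull_le _ _ _ (fun=> 0));
  [move=> n; rewrite pnorm0|exact: cvg_cst].
move=> x y /asboolP x0 /asboolP y0; apply/asboolP.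
rewrite addrC -scaleN1r; apply: (pnullD _ x0); exact: (pnullZ _ y0).
Qed.

HB.instance Definition _ := GRing.isZmodClosed.Build _ null_cseq null_cseq_zmod.

Definition completion := Quotient.quot null_cseq.

HB.instance Definition _ := GRing.Zmodule.on completion.

Definition cls (x : cseq) : completion := \pi_completion x.
Definition rep (q : completion) : cseq := repr q.

Lemma repK : cancel rep cls.
Proof. exact: reprK. Qed.

Lemma clsW (P : completion -> Prop) : (forall x, P (cls x)) -> forall q, P q.
Proof. by move=> h q; rewrite -(repK q). Qed.

Lemma eq_cls (x y : cseq) : cls x = cls y <-> pnull (x - y : cseq).
Proof.
split=> [h|h].
  have := Quotient.idealrBE null_cseq x y.
  by rewrite /= -/completion -/(cls x) -/(cls y) h eqxx => /asboolP.
by apply/eqP; rewrite -[_ == _]Quotient.idealrBE; exact/asboolP.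
Qed.

Lemma cls_rep x : pnull (rep (cls x) - x : cseq).
Proof. by apply/eq_cls; rewrite repK. Qed.

Lemma clsD x y : cls (x + y) = cls x + cls y.
Proof. exact: Quotient.pi_add. Qed.

Lemma cls0 : cls 0 = 0.
Proof. by apply: (addrI (cls 0)); rewrite -clsD !addr0. Qed.

Lemma clsN x : cls (- x) = - cls x.
Proof. by apply: (addrI (cls x)); rewrite -clsD !subrr cls0. Qed.

Lemma clsB x y : cls (x - y) = cls x - cls y.
Proof. by rewrite clsD clsN. Qed.

Definition cscale (k : R[i]) (q : completion) := cls (k *: rep q).
Definition cmulq (q r : completion) := cls (cseqM (rep q) (rep r)).
Definition cstarq (q : completion) := cls (cseq_star (rep q)).

Lemma cls_scale k x : cscale k (cls x) = cls (k *: x).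
Proof. by apply/eq_cls; rewrite -scalerBr; apply/pnullZ/cls_rep. Qed.

Lemma cls_mul x y : cmulq (cls x) (cls y) = cls (cseqM x y).
Proof.
apply/eq_cls.
have -> : \val (cseqM (rep (cls x)) (rep (cls y)) - cseqM x y : cseq) =
    ((fun n => (rep (cls x) - x : cseq) n * rep (cls y) n) +
     (fun n => x n * (rep (cls y) - y : cseq) n)).
  apply/funext => n; rewrite -[LHS]/(rep (cls x) n * rep (cls y) n - x n * y n).
  rewrite -[RHS]/((rep (cls x) n - x n) * rep (cls y) n +
                  x n * (rep (cls y) n - y n)).
  by rewrite mulrBl mulrBr addrA subrK.
by apply: pnullD; [apply: pnullMr|apply: pnullMl];
  (exact: cls_rep || exact: cseq_cauchy).
Qed.

Lemma cls_star x : cstarq (cls x) = cls (cseq_star x).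
Proof.
apply/eq_cls.
have -> : \val (cseq_star (rep (cls x)) - cseq_star x : cseq) =
    (fun n => pstar ((rep (cls x) - x : cseq) n)).
  by apply/funext => n; rewrite pstarB.
exact/pnull_pstar/cls_rep.
Qed.

Fact cscaleA a b q : cscale a (cscale b q) = cscale (a * b) q.
Proof. by elim/clsW: q => x; rewrite !cls_scale scalerA. Qed.
Fact cscale1 : left_id 1 cscale.
Proof. by elim/clsW => x; rewrite cls_scale scale1r. Qed.
Fact cscaleDr : right_distributive cscale +%R.
Proof.
move=> k q r; elim/clsW: q => x; elim/clsW: r => y.
by rewrite -clsD !cls_scale -clsD scalerDr.
Qed.
Fact cscaleDl q : {morph cscale^~ q : a b / a + b}.
Proof. by elim/clsW: q => x a b; rewrite !cls_scale -clsD scalerDl. Qed.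

HB.instance Definition _ := GRing.Zmodule_isLmodule.Build R[i] completion
  cscaleA cscale1 cscaleDr cscaleDl.

Lemma clsZ k x : cls (k *: x) = k *: cls x.
Proof. by rewrite -cls_scale. Qed.

(** Independent of the representative, by rnorm_cvg. *)
Definition rnorm (q : completion) : R := limn (fun n => pnorm (rep q n)).

Lemma rnorm_cvg (x : cseq) : pnorm (x n) @[n --> \oo] --> rnorm (cls x).
Proof.
have -> : rnorm (cls x) = limn (fun n => pnorm (x n)); last first.
  exact/pcauchy_cvg_pnorm/cseq_cauchy.
apply: cvg_lim => //.
have xl := pcauchy_cvg_pnorm (cseq_cauchy x).
rewrite -[l in _ --> l]addr0.
have -> : (fun n => pnorm (rep (cls x) n)) =
    (fun n => pnorm (x n) + (pnorm (rep (cls x) n) - pnorm (x n))).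
  by apply/funext => n; rewrite addrC subrK.
apply: cvgD => //; apply: norm_cvg0.
apply: squeeze_cvgr (cvg_cst (0 : R)) (cls_rep x).
by near=> n; rewrite normr_ge0 ler_dist_pnorm.
Unshelve. all: by end_near. Qed.

Lemma rnormE (x : cseq) (l : R) :
  pnorm (x n) @[n --> \oo] --> l -> rnorm (cls x) = l.
Proof. by move=> /cvg_lim <-//; apply/esym/cvg_lim => //; exact: rnorm_cvg. Qed.

Lemma ler_rnormD q r : rnorm (q + r) <= rnorm q + rnorm r.
Proof.
elim/clsW: q => x; elim/clsW: r => y; rewrite -clsD.
apply: (ler_limn (@rnorm_cvg (x + y))); last by move=> n; exact: ler_pnormD.
by apply: cvgD; exact: rnorm_cvg.
Qed.

Lemma rnormZ k q : rnorm (k *: q) = normc k * rnorm q.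
Proof.
elim/clsW: q => x; rewrite -clsZ; apply: rnormE.
rewrite (_ : (fun n => _) = fun n => normc k * pnorm (x n)); last first.
  by apply/funext => n; rewrite -pnormZ.
by apply: cvgM (@rnorm_cvg x); exact: cvg_cst.
Qed.

Lemma rnorm0_eq0 q : rnorm q = 0 -> q = 0.
Proof.
elim/clsW: q => x x0; rewrite -cls0; apply/eq_cls; rewrite subr0.
by rewrite /pnull -[X in _ --> X]x0; exact: rnorm_cvg.
Qed.

Lemma ler_rnormM q r : rnorm (cmulq q r) <= rnorm q * rnorm r.
Proof.
elim/clsW: q => x; elim/clsW: r => y; rewrite cls_mul.
apply: (ler_limn (@rnorm_cvg (cseqM x y))); last by move=> n; exact: ler_pnormM.
by apply: cvgM; exact: rnorm_cvg.
Qed.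

Lemma rnorm_starM q : rnorm (cmulq (cstarq q) q) = rnorm q ^+ 2.
Proof.
elim/clsW: q => x; rewrite cls_star cls_mul; apply: rnormE.
rewrite (_ : (fun n => _) = fun n => pnorm (x n) * pnorm (x n)); last first.
  by apply/funext => n; rewrite -expr2 -pnorm_pstarM.
by rewrite expr2; apply: cvgM (@rnorm_cvg x); exact: rnorm_cvg.
Qed.

Fact cnormD q r : (rnorm (q + r))%:C <= (rnorm q)%:C + (rnorm r)%:C.
Proof. by rewrite -rmorphD lecR ler_rnormD. Qed.
Fact cnormZ k q : (rnorm (k *: q))%:C = `|k| * (rnorm q)%:C.
Proof. by rewrite rnormZ rmorphM. Qed.
Fact cnorm0_eq0 q : (rnorm q)%:C = 0 -> q = 0.
Proof. by move=> /complexI; exact: rnorm0_eq0. Qed.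

HB.instance Definition _ := Lmodule_isNormed.Build R[i] completion
  cnormD cnormZ cnorm0_eq0.

Lemma completion_normE q : `|q| = (rnorm q)%:C.
Proof. by []. Qed.

End Completion.

Section CompletionCstar.
Context {R : realType} {D : preCstarType R} (S : starsub D).
Local Notation A := (completion S).
Implicit Types (d : D) (q r : A).

Lemma emb_subproof d :
  (if `[< carrier S d >] then fun=> d else 0) \in cauchy_in S.
Proof.
case: asboolP => [Sd|_]; apply/asboolP; split=> //; try exact: pcauchy_cst.
by move=> n; exact: starsub0 (starsubP S).
Qed.

Definition emb_cseq d : cseq S := CSeq (emb_subproof d).

Lemma emb_cseqE d n : carrier S d -> emb_cseq d n = d.
Proof. by move=> Sd; rewrite /= asboolT. Qed.

(** Elements d outside S are sent to 0. *)
Definition emb d : A := cls (emb_cseq d).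

Lemma rnorm_emb d : carrier S d -> rnorm (emb d) = pnorm d.
Proof.
move=> Sd; apply: rnormE; rewrite /= asboolT//; exact: cvg_cst.
Qed.

Lemma embZD (k : R[i]) d d' : carrier S d -> carrier S d' ->
  emb (k *: d + d') = k *: emb d + emb d'.
Proof.
move=> Sd Sd'; rewrite /emb -clsZ -clsD; congr cls; apply/val_inj/funext => n /=.
rewrite asboolT; last exact: starsubZD (starsubP S) _ _ _ Sd Sd'.
by rewrite -[RHS]/(k *: emb_cseq d n + emb_cseq d' n) !emb_cseqE.
Qed.

Lemma emb0 : emb 0 = 0.
Proof.
rewrite /emb -cls0; congr cls; apply/val_inj/funext => n /=.
by rewrite asboolT//; exact: starsub0 (starsubP S).
Qed.

Lemma embB d d' : carrier S d -> carrier S d' -> emb (d - d') = emb d - emb d'.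
Proof. by move=> Sd Sd'; rewrite addrC -scaleN1r embZD// scaleN1r addrC. Qed.

Lemma emb_mul d d' : carrier S d -> carrier S d' ->
  emb (d * d') = cmulq (emb d) (emb d').
Proof.
move=> Sd Sd'; rewrite /emb cls_mul; congr cls; apply/val_inj/funext => n /=.
by rewrite !asboolT//; exact: starsubM (starsubP S) _ _ Sd Sd'.
Qed.

Lemma emb_star d : carrier S d -> emb (pstar d) = cstarq (emb d).
Proof.
move=> Sd; rewrite /emb cls_star; congr cls; apply/val_inj/funext => n /=.
by rewrite !asboolT//; exact: starsub_star (starsubP S) _ Sd.
Qed.

Lemma rnorm_cls_emb (x : cseq S) (e : R) : 0 < e ->
  exists N, forall n, (N <= n)%N -> rnorm (cls x - emb (x n)) <= e.
Proof.
move=> e0; have [N hN] := cseq_cauchy x e0; exists N => n Nn.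
have h := @rnorm_cvg _ _ _ (x - emb_cseq (x n)).
rewrite /emb -clsB -(cvg_lim (@Rhausdorff R) h).
apply: limr_le; first by apply/cvg_ex; exists (rnorm (cls (x - emb_cseq (x n)))).
exists N => // m /= Nm.
rewrite -[_ m]/(x m - emb_cseq (x n) m) emb_cseqE ?ltW ?hN//; exact: cseq_in.
Qed.

Lemma rnormN q : rnorm (- q) = rnorm q.
Proof. by apply/complexI; rewrite -!completion_normE normrN. Qed.

Lemma rnormBC q r : rnorm (q - r) = rnorm (r - q).
Proof. by rewrite -rnormN opprB. Qed.

Lemma rnorm_triangle q r s : rnorm (q - s) <= rnorm (q - r) + rnorm (r - s).
Proof. by rewrite (le_trans _ (ler_rnormD _ _))// addrA subrK. Qed.

Lemma emb_dense q (e : R) : 0 < e -> exists2 d, carrier S d & rnorm (q - emb d) <= e.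
Proof.
elim/(@clsW _ _ S): q => x /(rnorm_cls_emb x)[N hN]; exists (x N); last exact: hN.
exact: cseq_in.
Qed.

(** Each ball of radius 1 / (n + 1) in the Cauchy filter has its centre within
1 / (n + 1) of some d_n in S; the sequence of the d_n is then Cauchy, and its
class is a limit of the filter. *)
Lemma completion_complete (F : set_system A) :
  ProperFilter F -> cauchy F -> cvg F.
Proof.
move=> FF /cauchyP Fc.
have /choice[u hu] n : exists dq : D * A, [/\ carrier S dq.1,
    rnorm (dq.2 - emb dq.1) <= n.+1%:R^-1 &
    F [set r | rnorm (dq.2 - r) < n.+1%:R^-1]].
  have e0 : 0 < n.+1%:R^-1 :> R by [].
  have [|q Fq] := Fc (n.+1%:R^-1)%:C; first by rewrite ltcR.
  have [d Sd dq] := emb_dense q e0; exists (d, q); split=> //.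
  by apply: filterS Fq => r; rewrite -ball_normE /ball_/= completion_normE ltcR.
have dc : (fun n => (u n).1) \in cauchy_in S.
  apply/asboolP; split; first by move=> n; case: (hu n).
  move=> e e0; have [N hN] := natSinv_lt (divr_gt0 e0 (ltr0Sn R 3)).
  exists N => m n Nm Nn.
  have [Sm hm Fm] := hu m; have [Sn hn Fn] := hu n.
  have [z [zm zn]] := filter_ex (filterI Fm Fn).
  have SB : carrier S ((u m).1 - (u n).1).
    rewrite addrC -scaleN1r.
    exact: starsubZD (starsubP S) _ _ _ Sn Sm.
  rewrite -rnorm_emb// embB//.
  have h1 := rnorm_triangle (emb (u m).1) (u m).2 (emb (u n).1).
  have h2 := rnorm_triangle (u m).2 z (emb (u n).1).
  have h3 := rnorm_triangle z (u n).2 (emb (u n).1).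
  have em := hN _ Nm; have en := hN _ Nn; rewrite (rnormBC _ (u m).2) in h1.
  rewrite (rnormBC z (u n).2) in h3.
  have -> : e = e / 4 + (e / 4 + (e / 4 + e / 4)) by lra.
  apply: (le_lt_trans h1); apply: ltrD; first exact: le_lt_trans em.
  apply: (le_lt_trans h2); apply: ltrD; first exact: lt_trans em.
  apply: (le_lt_trans h3); apply: ltrD; first exact: lt_trans en.
  exact: le_lt_trans en.
pose l := cls (CSeq dc); apply/cvg_ex; exists l.
apply/cvgrPdist_lt => e /gt0_complexP[e' e0 ->].
have [N1 h1] := natSinv_lt (divr_gt0 e0 (ltr0Sn R 3)).
have [N2 h2] := rnorm_cls_emb (CSeq dc) (divr_gt0 e0 (ltr0Sn R 3)).
pose n := maxn N1 N2.
have {}h1 := h1 n (leq_maxl _ _); have {}h2 := h2 n (leq_maxr _ _).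
have [_ hn Fn] := hu n; apply: filterS Fn => z /= Fz.
rewrite completion_normE ltcR.
have g1 := rnorm_triangle l (emb (u n).1) z.
have g2 := rnorm_triangle (emb (u n).1) (u n).2 z.
rewrite (rnormBC _ (u n).2) in g2.
have -> : e' = e' / 4 + (e' / 4 + (e' / 4 + e' / 4)) by lra.
apply: (le_lt_trans g1); apply: ler_ltD; first exact: h2.
apply: (le_lt_trans g2); apply: ltrD; first exact: le_lt_trans h1.
by apply: (lt_trans Fz); apply: (lt_trans h1); rewrite ltrDl divr_gt0.
Qed.

HB.instance Definition _ := Uniform_isComplete.Build A completion_complete.

Fact cmulqA : associative (@cmulq _ _ S).
Proof.
move=> q r s.
elim/(@clsW _ _ S): q => x; elim/(@clsW _ _ S): r => y;
  elim/(@clsW _ _ S): s => z.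
by rewrite !cls_mul; congr cls; apply/val_inj/funext => n /=; rewrite mulrA.
Qed.
Fact cmulqDl : left_distributive (@cmulq _ _ S) +%R.
Proof.
move=> q r s.
elim/(@clsW _ _ S): q => x; elim/(@clsW _ _ S): r => y;
  elim/(@clsW _ _ S): s => z.
rewrite -clsD !cls_mul -clsD; congr cls; apply/val_inj/funext => n /=.
exact: mulrDl.
Qed.
Fact cmulqDr : right_distributive (@cmulq _ _ S) +%R.
Proof.
move=> q r s.
elim/(@clsW _ _ S): q => x; elim/(@clsW _ _ S): r => y;
  elim/(@clsW _ _ S): s => z.
rewrite -clsD !cls_mul -clsD; congr cls; apply/val_inj/funext => n /=.
exact: mulrDr.
Qed.
Fact cmulqZl (k : R[i]) q r : cmulq (k *: q) r = k *: cmulq q r.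
Proof.
elim/(@clsW _ _ S): q => x; elim/(@clsW _ _ S): r => y;
  rewrite -clsZ !cls_mul -clsZ; congr cls.
by apply/val_inj/funext => n /=; exact/esym/scalerAl.
Qed.
Fact cmulqZr (k : R[i]) q r : cmulq q (k *: r) = k *: cmulq q r.
Proof.
elim/(@clsW _ _ S): q => x; elim/(@clsW _ _ S): r => y;
  rewrite -clsZ !cls_mul -clsZ; congr cls.
by apply/val_inj/funext => n /=; exact/esym/scalerAr.
Qed.
Fact cstarqK : involutive (@cstarq _ _ S).
Proof.
elim/(@clsW _ _ S) => x; rewrite !cls_star; congr cls.
by apply/val_inj/funext => n /=; exact: pstarK.
Qed.
Fact cstarqD : {morph @cstarq _ _ S : q r / q + r}.
Proof.
move=> q r; elim/(@clsW _ _ S): q => x; elim/(@clsW _ _ S): r => y.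
rewrite -clsD !cls_star -clsD; congr cls.
by apply/val_inj/funext => n /=; exact: pstarD.
Qed.
Fact cstarqZ (k : R[i]) q : cstarq (k *: q) = (k^*)%R *: cstarq q.
Proof.
elim/(@clsW _ _ S): q => x; rewrite -clsZ !cls_star -clsZ; congr cls.
apply/val_inj/funext => n; rewrite -[LHS]/(pstar (k *: x n)).
by rewrite -[RHS]/((k^*)%R *: pstar (x n)) pstarZ.
Qed.
Fact cstarqM q r : cstarq (cmulq q r) = cmulq (cstarq r) (cstarq q).
Proof.
elim/(@clsW _ _ S): q => x; elim/(@clsW _ _ S): r => y;
  rewrite cls_mul !cls_star cls_mul.
by congr cls; apply/val_inj/funext => n /=; exact: pstarM.
Qed.
Fact cnormqM q r : `|cmulq q r| <= `|q| * `|r|.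
Proof. by rewrite !completion_normE -rmorphM lecR ler_rnormM. Qed.
Fact cnormq_star q : `|cmulq (cstarq q) q| = `|q| ^+ 2.
Proof. by rewrite !completion_normE rnorm_starM rmorphXn. Qed.

HB.instance Definition _ := CompleteNormedModule_isCstarAlgebra.Build R A
  cmulqA cmulqDl cmulqDr cmulqZl cmulqZr cstarqK cstarqD cstarqZ cstarqM
  cnormqM cnormq_star.

End CompletionCstar.

(** * Finite-dimensional subspaces are closed *)

Section FiniteDimensionalClosed.
Context {R : realType}.

Lemma normc_ge_parts (a b : R) : `|a| <= normc (a +i* b) /\ `|b| <= normc (a +i* b).
Proof.
by rewrite /= -!sqrtr_sqr !ler_sqrt ?addr_ge0 ?sqr_ge0// lerDl lerDr !sqr_ge0.
Qed.

Lemma normc_le_parts (a b : R) : normc (a +i* b) <= `|a| + `|b|.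
Proof.
rewrite /= -[leRHS]ger0_norm ?addr_ge0// -sqrtr_sqr ler_sqrt ?sqr_ge0//.
rewrite sqrrD !real_normK ?num_real// addrAC lerDl.
by rewrite mulrn_wge0// mulr_ge0.
Qed.

Lemma cauchy_cvg_complex (c : nat -> R[i]) :
  (forall e : R, 0 < e -> exists N, forall m n, (N <= m)%N -> (N <= n)%N ->
     normc (c m - c n) < e) ->
  exists l, forall e : R, 0 < e -> exists N, forall n, (N <= n)%N ->
     normc (l - c n) < e.
Proof.
move=> cc.
have rec : cvgn (fun n => complex.Re (c n)).
  apply: cauchy_cvg_real => e /cc[N hN]; exists N => m n Nm Nn.
  apply: le_lt_trans (hN _ _ Nm Nn).
  by case: (c m) (c n) => a b [a' b']; exact: (normc_ge_parts _ _).1.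
have imc : cvgn (fun n => complex.Im (c n)).
  apply: cauchy_cvg_real => e /cc[N hN]; exists N => m n Nm Nn.
  apply: le_lt_trans (hN _ _ Nm Nn).
  by case: (c m) (c n) => a b [a' b']; exact: (normc_ge_parts _ _).2.
set a := limn _ in rec; set b := limn _ in imc; exists (a +i* b) => e e0.
have /cvgrPdist_lt/(_ _ (divr_gt0 e0 (ltr0Sn R 1)))[N1 _ h1] := rec.
have /cvgrPdist_lt/(_ _ (divr_gt0 e0 (ltr0Sn R 1)))[N2 _ h2] := imc.
exists (maxn N1 N2) => n; rewrite geq_max => /andP[n1 n2].
have {h1} := h1 _ n1; have {h2} := h2 _ n2 => /=.
case: (c n) => a' b' /= hb ha.
rewrite (le_lt_trans (normc_le_parts _ _))// [e]splitr; exact: ltrD.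
Qed.

Section NormedModule.
Context {X : normedModType R[i]}.
Implicit Types x y : X.

Lemma norm_complexE x : `|x| = (complex.Re `|x|)%:C.
Proof. by rewrite RRe_real// ger0_real. Qed.

Lemma closureP_norm (B : set X) x : closure B x <->
  forall e : R, 0 < e -> exists2 y, B y & `|x - y| < e%:C.
Proof.
split=> [h e e0|h U].
  have [|y [By xy]] := h (ball x e%:C); first by apply: nbhsx_ballx; rewrite ltcR.
  by exists y => //; move: xy; rewrite -ball_normE.
rewrite -nbhs_ballE => -[_/= /gt0_complexP[e e0 ->] xeU].
have [y By xy] := h _ e0; exists y; split=> //; apply: xeU.
by rewrite -ball_normE.
Qed.

(** Adding one vector w to a closed subspace W keeps it closed: if w is at
positive distance r from W, then the coefficients of w in a convergent sequence
of W + C w are Cauchy, because |c - c'| r <= |(c w + y) - (c' w + y')|. *)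
Lemma closed_add_line (W : set X) (w : X) :
  (forall (k : R[i]) x y, W x -> W y -> W (k *: x + y)) -> closed W ->
  closed [set x | exists2 y, W y & exists k : R[i], x = y + k *: w].
Proof.
move=> WZD clW x xcl.
have [Ww|nWw] := pselect (W w).
  have clx : closure W x.
    apply/closureP_norm => e e0.
    have [_ [y Wy [k ->]] h] := (closureP_norm _ _).1 xcl _ e0.
    by exists (y + k *: w) => //; rewrite addrC; exact: WZD.
  by exists x; [exact: clW|exists 0; rewrite scale0r addr0].
(* w is at a positive distance from W, as W is closed *)
have [r r0 hr] : exists2 r : R, 0 < r & forall y, W y -> r%:C <= `|w - y|.
  apply: contrapT => h; apply: nWw; apply: clW; apply/closureP_norm => e e0.
  apply: contrapT => h'; apply: h; exists e => // y Wy.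
  rewrite norm_complexE lecR leNgt; apply/negP => hy; apply: h'; exists y => //.
  by rewrite norm_complexE ltcR.
have W0 y : W y -> W 0.
  by move=> Wy; have := WZD (-1) _ _ Wy Wy; rewrite scaleN1r addNr.
have WN y : W y -> forall k : R[i], W (k *: y).
  by move=> Wy k; rewrite -[k *: y]addr0; apply: WZD => //; exact: W0 Wy.
have hk (k : R[i]) y : W y -> (normc k * r)%:C <= `|k *: w + y|.
  move=> Wy; have [->|k0] := eqVneq k 0.
    by rewrite normc0 mul0r normr_ge0.
  have -> : k *: w + y = k *: (w - (- k^-1) *: y).
    by rewrite scalerBr scalerA mulrN divff// scaleN1r opprK.
  rewrite normrZ rmorphM ler_wpM2l ?lecR ?normc_ge0//.
  by apply: hr; exact: WN.
have /choice[yk hyk] n : exists yk : X * R[i],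
    W yk.1 /\ `|x - (yk.1 + yk.2 *: w)| < (n.+1%:R^-1)%:C.
  have [|_ [y Wy [k ->]] h] := (closureP_norm _ _).1 xcl n.+1%:R^-1.
    by rewrite invr_gt0.
  by exists (y, k).
have [|k hkl] := @cauchy_cvg_complex (fun n => (yk n).2).
  move=> e e0; have [N hN] := natSinv_lt (divr_gt0 (mulr_gt0 e0 r0) (ltr0Sn R 1)).
  exists N => m n Nm Nn; have [Wm xm] := hyk m; have [Wn xn] := hyk n.
  rewrite -(ltr_pM2r r0) -ltcR.
  apply: (le_lt_trans (hk _ _ (WZD (-1) _ _ Wn Wm))).
  have -> : ((yk m).2 - (yk n).2) *: w + (-1 *: (yk n).1 + (yk m).1) =
     (x - ((yk n).1 + (yk n).2 *: w)) - (x - ((yk m).1 + (yk m).2 *: w)).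
    rewrite opprB [RHS]addrC [RHS]addrA subrK scalerBl scaleN1r opprD.
    by rewrite [RHS]addrACA [LHS]addrC [- _ + _]addrC.
  rewrite (le_lt_trans (ler_normB _ _))//.
  rewrite [e * r]splitr rmorphD ltrD//.
    by apply: (lt_trans xn); rewrite ltcR hN.
  by apply: (lt_trans xm); rewrite ltcR hN.
exists (x - k *: w); last by exists k; rewrite subrK.
apply: clW; apply/closureP_norm => e e0.
pose M := complex.Re `|w| + 1.
have M0 : 0 < M by rewrite ltr_wpDl// -lecR -norm_complexE; exact: normr_ge0.
have e20 := divr_gt0 e0 (ltr0Sn R 1).
have [N1 h1] := natSinv_lt e20; have [N2 h2] := hkl _ (divr_gt0 e20 M0).
pose n := maxn N1 N2; have {}h1 := h1 n (leq_maxl _ _).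
have {}h2 := h2 n (leq_maxr _ _).
have [Wn xn] := hyk n; exists (yk n).1 => //.
have -> : x - k *: w - (yk n).1 =
    (x - ((yk n).1 + (yk n).2 *: w)) - (k - (yk n).2) *: w.
  by rewrite scalerBl opprB opprD !addrA subrK addrAC.
rewrite (le_lt_trans (ler_normB _ _))// [e]splitr rmorphD ltrD//.
  by apply: (lt_trans xn); rewrite ltcR.
rewrite normrZ norm_complexE -rmorphM ltcR.
rewrite (@le_lt_trans _ _ (normc (k - (yk n).2) * M))//.
  by rewrite ler_wpM2l ?normc_ge0 ?lerDl.
by rewrite -ltr_pdivlMr.
Qed.

(** The lines spanned by the vectors are added one at a time. *)
Lemma closed_span (s : seq X) :
  closed [set \sum_(i < size s) c i *: s`_i | c in [set: nat -> R[i]]].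
Proof.
elim/last_ind: s => [|s w ih].
  rewrite [X in closed X](_ : _ = [set 0]); first
    exact: accessible_closed_set1 (hausdorff_accessible (@norm_hausdorff _ _)) 0.
  apply/seteqP; split=> x /=.
    by move=> [c _ <-]; rewrite big_ord0.
  by move=> ->; exists (fun=> 0) => //; rewrite big_ord0.
rewrite [X in closed X](_ : _ = [set x | exists2 y,
    [set \sum_(i < size s) c i *: s`_i | c in [set: nat -> R[i]]] y &
    exists k : R[i], x = y + k *: w]).
  apply: closed_add_line ih => k _ _ [c _ <-] [c' _ <-].
  exists (fun i => k * c i + c' i) => //.
  rewrite scaler_sumr -big_split/=; apply: eq_bigr => i _.
  by rewrite scalerA scalerDl.
apply/seteqP; split=> x /=.
  move=> [c _ <-]; rewrite size_rcons big_ord_recr/=.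
  exists (\sum_(i < size s) c i *: s`_i); first by exists c.
  exists (c (size s)); rewrite nth_rcons ltnn eqxx; congr (_ + _).
  by apply: eq_bigr => i _; rewrite nth_rcons ltn_ord.
move=> [_ [c _ <-] [k ->]].
exists (fun i => if (i < size s)%N then c i else k) => //.
rewrite size_rcons big_ord_recr/= ltnn nth_rcons ltnn eqxx; congr (_ + _).
by apply: eq_bigr => i _; rewrite nth_rcons ltn_ord.
Qed.

End NormedModule.
End FiniteDimensionalClosed.

(** * AF algebras from increasing finite families *)

Section Span.
Context {R : realType} {D : preCstarType R}.
Implicit Types (s : seq D) (d : D).

Definition lin_span s : set D :=
  [set \sum_(i < size s) c i *: s`_i | c in [set: nat -> R[i]]].

Lemma spanZD s (k : R[i]) d d' :
  lin_span s d -> lin_span s d' -> lin_span s (k *: d + d').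
Proof.
move=> [c _ <-] [c' _ <-]; exists (fun i => k * c i + c' i) => //.
rewrite scaler_sumr -big_split/=; apply: eq_bigr => i _.
by rewrite scalerA scalerDl.
Qed.

Lemma span0 s : lin_span s 0.
Proof. by exists (fun=> 0) => //; rewrite big1// => i _; rewrite scale0r. Qed.

Lemma spanD s d d' : lin_span s d -> lin_span s d' -> lin_span s (d + d').
Proof. by move=> sd sd'; rewrite -[d]scale1r; exact: spanZD. Qed.

Lemma spanZ s (k : R[i]) d : lin_span s d -> lin_span s (k *: d).
Proof. by move=> sd; rewrite -[_ *: _]addr0; apply: spanZD => //; exact: span0. Qed.

Lemma spanB s d d' : lin_span s d -> lin_span s d' -> lin_span s (d - d').
Proof. by move=> sd sd'; rewrite addrC -scaleN1r; exact: spanZD. Qed.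

Lemma span_sum s (I : Type) (r : seq I) (P : pred I) (F : I -> D) :
  (forall i, P i -> lin_span s (F i)) -> lin_span s (\sum_(i <- r | P i) F i).
Proof.
by move=> sF; elim/big_ind: _ => //; [exact: span0|exact: spanD].
Qed.

Lemma mem_span s d : d \in s -> lin_span s d.
Proof.
move=> ds; have ids : (index d s < size s)%N by rewrite index_mem.
exists (fun i => (i == index d s)%:R) => //.
rewrite (bigD1 (Ordinal ids))//= eqxx scale1r nth_index// big1 ?addr0// => i.
by rewrite -val_eqE /= => /negPf ->; rewrite scale0r.
Qed.

Lemma span_ind s (W : set D) : W 0 ->
  (forall (k : R[i]) d d', W d -> W d' -> W (k *: d + d')) ->
  (forall d, d \in s -> W d) -> lin_span s `<=` W.
Proof.
move=> W0 WZD Ws _ [c _ <-]; elim/big_ind: _ => //.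
  by move=> d d' Wd Wd'; rewrite -[d]scale1r; exact: WZD.
by move=> i _; rewrite -[_ *: _]addr0; apply: WZD => //; exact/Ws/mem_nth.
Qed.

Lemma span_sub s s' : {subset s <= s'} -> lin_span s `<=` lin_span s'.
Proof.
move=> ss'; apply: span_ind; [exact: span0|exact: spanZD|].
by move=> d /ss'; exact: mem_span.
Qed.

(** By bilinearity, products need only be checked on the spanning family. *)
Lemma span_mul s : {in s &, forall d d', lin_span s (d * d')} ->
  forall d d', lin_span s d -> lin_span s d' -> lin_span s (d * d').
Proof.
move=> sM d d' sd; move: d'.
apply: span_ind; first by rewrite mulr0; exact: span0.
  by move=> k a b sa sb; rewrite mulrDr -scalerAr; exact: spanZD.
move=> d' sd'; move: d sd.
apply: span_ind; first by rewrite mul0r; exact: span0.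
  by move=> k a b sa sb; rewrite mulrDl -scalerAl; exact: spanZD.
by move=> d sd; exact: sM.
Qed.

Lemma span_star s : {in s, forall d, lin_span s (pstar d)} ->
  forall d, lin_span s d -> lin_span s (pstar d).
Proof.
move=> sA; apply: span_ind; first by rewrite pstar0; exact: span0.
  by move=> k a b sa sb; rewrite pstarD pstarZ; exact: spanZD.
exact: sA.
Qed.

End Span.

Section AFCriterion.
Context {R : realType} {D : preCstarType R} (T : nat -> seq D).
Hypothesis T_incr : forall n, {subset T n <= T n.+1}.
Hypothesis T_mul : forall n, {in T n &, forall d d', lin_span (T n) (d * d')}.
Hypothesis T_star : forall n, {in T n, forall d, lin_span (T n) (pstar d)}.

Definition span_union : set D := \bigcup_n lin_span (T n).

Lemma span_incr m n : (m <= n)%N -> lin_span (T m) `<=` lin_span (T n).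
Proof.
move=> mn; apply: span_sub; elim: n mn => [|n ih].
  by rewrite leqn0 => /eqP ->.
rewrite leq_eqVlt => /predU1P[->//|]; rewrite ltnS => /ih h d /h.
exact: T_incr.
Qed.

Lemma span_union_starsub : is_starsub span_union.
Proof.
split.
- by exists 0%N => //; exact: span0.
- move=> k a b [m _ ma] [n _ nb]; exists (maxn m n) => //; apply: spanZD.
    exact: span_incr (leq_maxl m n) _ ma.
  exact: span_incr (leq_maxr m n) _ nb.
- move=> a b [m _ ma] [n _ nb]; exists (maxn m n) => //.
  apply: (span_mul (@T_mul _)).
    exact: span_incr (leq_maxl m n) _ ma.
  exact: span_incr (leq_maxr m n) _ nb.
- by move=> a [m _ ma]; exists m => //; exact: (span_star (@T_star _)).
Qed.

Definition span_union_sub : starsub D := Starsub span_union_starsub.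

Local Notation A := (completion span_union_sub : cstarAlgType R).
Local Notation emb := (@emb R D span_union_sub).

(** Exhibits the image of a span as a span in the completion, to which closed_span
and the definition of finite dimension apply. *)
Lemma emb_span n : emb @` lin_span (T n) =
  [set \sum_(i < size (map emb (T n))) c i *: (map emb (T n))`_i
  | c in [set: nat -> R[i]]].
Proof.
have eqc (c : nat -> R[i]) : emb (\sum_(i < size (T n)) c i *: (T n)`_i) =
    \sum_(i < size (map emb (T n))) c i *: (map emb (T n))`_i.
  rewrite size_map; have cT d : lin_span (T n) d -> carrier span_union_sub d.
    by move=> sd; exists n.
  suff : forall m, (m <= size (T n))%N ->
      emb (\sum_(i < m) c i *: (T n)`_i) =
        \sum_(i < m) c i *: (map emb (T n))`_i by exact.
  elim=> [_|m ih mn]; first by rewrite !big_ord0 emb0.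
  rewrite !big_ord_recr/= -ih ?(ltnW mn)// addrC embZD.
  - by rewrite addrC (nth_map 0).
  - exact/cT/mem_span/mem_nth.
  - apply/cT/span_sum => i _; apply/spanZ/mem_span/mem_nth.
    by apply: ltn_trans mn.
apply/seteqP; split=> x /=.
  by move=> [_ [c _ <-] <-]; exists c.
move=> [c _ <-]; exists (\sum_(i < size (T n)) c i *: (T n)`_i); last exact: eqc.
by exists c.
Qed.

(** The union of the spans is the subalgebra that was completed, hence dense. *)
Lemma completion_AF : is_AF A.
Proof.
have cT n d : lin_span (T n) d -> carrier span_union_sub d by move=> sd; exists n.
exists (fun n => emb @` lin_span (T n)); split.
- move=> n; split; last first.
    exists (size (map emb (T n))), (fun i => (map emb (T n))`_i).
    rewrite emb_span; apply/seteqP; split=> x /= [c _ <-].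
      by exists (fun i => c i).
    exists (fun i => if insub i is Some j then c j else 0) => //.
    by apply: eq_bigr => i _; rewrite valK.
  split.
  + by exists 0; [exact: span0|exact: emb0].
  + move=> k _ _ [a sa <-] [b sb <-]; exists (k *: a + b); first exact: spanZD.
    by rewrite embZD; [|exact: cT sa|exact: cT sb].
  + move=> _ _ [a sa <-] [b sb <-]; exists (a * b).
      exact: (span_mul (@T_mul n)).
    by rewrite emb_mul; [|exact: cT sa|exact: cT sb].
  + move=> _ [a sa <-]; exists (pstar a); first exact: (span_star (@T_star n)).
    by rewrite emb_star; [|exact: cT sa].
  + by rewrite emb_span; exact: closed_span.
- by move=> n _ [d sd <-]; exists d => //; exact: span_sub (@T_incr n) _ sd.
- apply/seteqP; split=> // q _; apply/closureP_norm => e e0.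
  have [d [n _ sd] qd] := emb_dense q (divr_gt0 e0 (ltr0Sn R 1)).
  exists (emb d); first by exists n => //; exists d.
  rewrite completion_normE ltcR (le_lt_trans qd)//.
  by rewrite ltr_pdivrMr// mulr_natr mulr2n ltrDl.
Qed.

End AFCriterion.

(** * Positivity and limits of nilpotents in the completion *)

Section PositiveLimitOfNilpotents.
Context {R : realType} {D : preCstarType R} (S : starsub D).
Local Notation A := (completion S : cstarAlgType R).
Hypothesis S1 : carrier S 1.

Lemma emb1_identity : is_identity (emb S 1 : A).
Proof.
by elim/(@clsW _ _ S) => x; rewrite /emb; split;
  rewrite [LHS]cls_mul; congr cls; apply/val_inj/funext => n;
  rewrite -[LHS]/(_ n * _ n) emb_cseqE// ?mul1r ?mulr1.
Qed.

(** Resolvents pass to the limit: if the elements l - x_n have inverses that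
form a Cauchy sequence, then the class of that sequence inverts l - x. *)
Lemma positive_cls (x : cseq S) : (forall n, pstar (x n) = x n) ->
  (forall l : R[i], ~~ (0 <= l) -> exists y : cseq S, forall n,
     (l%:A - x n) * y n = 1 /\ y n * (l%:A - x n) = 1) ->
  positive A (cls x).
Proof.
move=> xsa xres; split.
  rewrite /selfadjoint [LHS]cls_star; congr cls; apply/val_inj/funext => n.
  exact: xsa.
move=> l [lsp _] /=; apply: contrapT => /negP/xres[y hy].
apply: (lsp _ emb1_identity); exists (cls y).
have -> : l *: (emb S 1 : A) - cls x = cls (l *: emb_cseq S 1 - x).
  by rewrite clsB clsZ.
have lxE n : (l *: emb_cseq S 1 - x) n = l%:A - x n.
  by rewrite -[LHS]/(l *: emb_cseq S 1 n - x n) emb_cseqE.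
by split; rewrite [LHS]cls_mul /emb; congr cls; apply/val_inj/funext => n;
  rewrite -[RHS]/(emb_cseq S 1 n) emb_cseqE// -[LHS]/(_ n * _ n) lxE;
  have [] := hy n.
Qed.

Lemma nilpotent_emb d m : carrier S d -> d ^+ m.+1 = 0 -> nilpotents A (emb S d).
Proof.
move=> Sd dm; exists m.
suff h k : carrier S (d ^+ k.+1) /\
    iter k (cmul (emb S d : A)) (emb S d) = emb S (d ^+ k.+1).
  by rewrite (h m).2 dm emb0.
elim: k => [|k [Sk ih]]; first by rewrite expr1.
rewrite exprS iterS ih emb_mul//; split=> //.
exact: starsubM (starsubP S) _ _ Sd Sk.
Qed.

Lemma closure_nilpotents_cls (x : cseq S) (d : nat -> D) (m : nat -> nat) :
  (forall n, carrier S (d n)) -> (forall n, d n ^+ (m n).+1 = 0) ->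
  (forall e : R, 0 < e -> exists N, forall n, (N <= n)%N ->
     pnorm (x n - d n) <= e) ->
  closure (nilpotents A) (cls x).
Proof.
move=> Sd dm xd; apply/closureP_norm => e e0.
have e30 := divr_gt0 e0 (ltr0Sn R 2).
have [N1 h1] := rnorm_cls_emb x e30; have [N2 h2] := xd _ e30.
pose n := maxn N1 N2; exists (emb S (d n)); first exact: nilpotent_emb (dm n).
rewrite completion_normE ltcR.
have {}h1 := h1 n (leq_maxl _ _); have {}h2 := h2 n (leq_maxr _ _).
rewrite (le_lt_trans (rnorm_triangle _ (emb S (x n)) _))//.
rewrite -embB//; last exact: cseq_in.
have SB : carrier S (x n - d n).
  rewrite addrC -scaleN1r; apply: starsubZD (starsubP S) _ _ _ (Sd n) _.
  exact: cseq_in.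
rewrite rnorm_emb//.
have -> : e = e / 3 + e / 3 + e / 3 by lra.
rewrite (le_lt_trans (lerD h1 h2))// ltrDl//.
Qed.

Lemma cls_neq0 (x : cseq S) : (forall n, 1 <= pnorm (x n)) -> cls x != 0.
Proof.
move=> x1; apply/eqP => x0.
have : 1 <= rnorm (cls x).
  rewrite -(cvg_lim (@Rhausdorff R) (@rnorm_cvg _ _ _ x)); apply: limr_ge.
    exact/pcauchy_cvg_pnorm/cseq_cauchy.
  by exists 0%N => // n _ /=.
rewrite x0 -cls0 (@rnormE _ _ _ 0 0) ?ler10//.
rewrite (_ : (fun n => _) = fun=> 0); first exact: cvg_cst.
by apply/funext => n; exact: pnorm0.
Qed.

End PositiveLimitOfNilpotents.

(** * Bounded adjointable operators on a pre-Hilbert space *)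

HB.mixin Record isPreHilbert (R : realType) V of GRing.Lmodule R[i] V := {
  dotp : V -> V -> R[i] ;
  dotpDl : forall u v w, dotp (u + v) w = dotp u w + dotp v w ;
  dotpZl : forall k u v, dotp (k *: u) v = k * dotp u v ;
  dotpC : forall u v, dotp u v = ((dotp v u)^*)%R ;
  dotp_ge0 : forall v, 0 <= dotp v v ;
  dotp_eq0 : forall v, dotp v v = 0 -> v = 0 ;
  preHilbert_neq0 : exists v : V, v != 0
}.

#[short(type="preHilbertType")]
HB.structure Definition PreHilbert (R : realType) :=
  {V of GRing.Lmodule R[i] V & isPreHilbert R V}.

Lemma sqr_normcC (R : realType) (k : R[i]) : (normc k ^+ 2)%:C = `|k| ^+ 2.
Proof. exact: (rmorphXn (real_complex R) 2 (normc k)). Qed.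

Section PreHilbertTheory.
Context {R : realType} {V : preHilbertType R}.
Implicit Types u v w : V.

Lemma dotp0l v : dotp 0 v = 0.
Proof. by rewrite -(scale0r (0 : V)) dotpZl mul0r. Qed.

Lemma dotpNl u v : dotp (- u) v = - dotp u v.
Proof. by rewrite -scaleN1r dotpZl mulN1r. Qed.

Lemma dotpDr u v w : dotp u (v + w) = dotp u v + dotp u w.
Proof. by rewrite dotpC dotpDl rmorphD/= -!dotpC. Qed.

Lemma dotpZr k u v : dotp u (k *: v) = (k^*)%R * dotp u v.
Proof. by rewrite dotpC dotpZl rmorphM/= -dotpC. Qed.

Lemma dotpNr u v : dotp u (- v) = - dotp u v.
Proof. by rewrite -scaleN1r dotpZr rmorphN rmorph1 mulN1r. Qed.

Lemma dotp_inj u v : (forall w, dotp u w = dotp v w) -> u = v.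
Proof.
move=> uv; apply/eqP; rewrite -subr_eq0; apply/eqP/dotp_eq0.
by rewrite dotpDl dotpNl uv subrr.
Qed.

Definition vnorm v : R := Num.sqrt (complex.Re (dotp v v)).

Lemma vnorm_ge0 v : 0 <= vnorm v. Proof. exact: sqrtr_ge0. Qed.

Lemma dotpE v : dotp v v = (vnorm v ^+ 2)%:C.
Proof.
have := dotp_ge0 v; rewrite /vnorm; case: (dotp v v) => a b.
by rewrite lecE/= => /andP[/eqP -> a0]; rewrite sqr_sqrtr.
Qed.

Lemma vnorm_eq0 v : vnorm v = 0 -> v = 0.
Proof. by move=> v0; apply: dotp_eq0; rewrite dotpE v0 expr0n. Qed.

Lemma vnorm0 : vnorm 0 = 0.
Proof. by rewrite /vnorm dotp0l sqrtr0. Qed.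

Lemma vnormZ k v : vnorm (k *: v) = normc k * vnorm v.
Proof.
apply/eqP; rewrite -(@eqrXn2 _ 2)// ?vnorm_ge0 ?mulr_ge0 ?normc_ge0 ?vnorm_ge0//.
apply/eqP/complexI; rewrite -dotpE dotpZl dotpZr mulrA -normCK dotpE.
by rewrite -sqr_normcC -rmorphM -exprMn.
Qed.

(** Positivity of the square of the component of u orthogonal to v. *)
Lemma cauchy_schwarz u v : normc (dotp u v) <= vnorm u * vnorm v.
Proof.
have [->|v0] := eqVneq v 0.
  by rewrite -(scale0r (0 : V)) dotpZr rmorph0 mul0r normc0 mulr_ge0 ?vnorm_ge0.
have nv0 : 0 < vnorm v.
  by rewrite lt_def vnorm_ge0 andbT; apply: contra_neq v0; exact: vnorm_eq0.
have nvC0 : dotp v v != 0.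
  by rewrite dotpE -[0]/(0%:C) (inj_eq (@complexI _)) expf_neq0// gt_eqF.
rewrite -(@ler_pXn2r _ 2)// ?nnegrE ?mulr_ge0 ?normc_ge0 ?vnorm_ge0//.
(* c v is the orthogonal projection of u onto the line spanned by v *)
pose c := dotp u v / dotp v v.
have := dotp_ge0 (u - c *: v).
rewrite !(dotpDl, dotpDr, dotpNl, dotpNr, dotpZl, dotpZr).
have cr : ((dotp v v)^*)%R = dotp v v by rewrite -dotpC.
have -> : c * ((c^*)%R * dotp v v) = (c^*)%R * dotp u v.
  by rewrite mulrCA /c divfK.
rewrite subrr subr0.
have -> : c * dotp v u = (normc (dotp u v) ^+ 2 / vnorm v ^+ 2)%:C.
  by rewrite (dotpC v u) /c mulrAC -normCK dotpE -sqr_normcC -fmorphV -rmorphM.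
by rewrite dotpE -rmorphB lecR subr_ge0 ler_pdivrMr ?exprn_gt0// -exprMn.
Qed.

Lemma ler_vnormD u v : vnorm (u + v) <= vnorm u + vnorm v.
Proof.
rewrite -(@ler_pXn2r _ 2)// ?nnegrE ?addr_ge0 ?vnorm_ge0//.
rewrite sqrrD -[leLHS]/(complex.Re (vnorm (u + v) ^+ 2)%:C) -dotpE.
rewrite dotpDl !dotpDr (dotpC v u) [X in complex.Re X]addrA !dotpE.
have := cauchy_schwarz u v; case: (dotp u v) => a b /= h.
have [ha _] := normc_ge_parts a b.
have {ha h} : a <= vnorm u * vnorm v.
  by rewrite (le_trans _ h)// (le_trans _ ha)// ler_norm.
by move=> h; lra.
Qed.

End PreHilbertTheory.

Section BoundedOperators.
Context {R : realType} {V : preHilbertType R}.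
Implicit Types (T : V -> V) (u v w : V).

Definition opbound T (M : R) := forall v, vnorm (T v) <= M * vnorm v.

Definition adjoint T T' := forall u v, dotp (T u) v = dotp u (T' v).

(** Asking for an adjoint rather than proving its existence is what allows an
incomplete space V. *)
Definition bounded_adjointable : {pred V -> V} :=
  fun T => `[< (exists M, 0 <= M /\ opbound T M) /\ exists T', adjoint T T' >].

Lemma bounded_adjointable_submod : submod_closed bounded_adjointable.
Proof.
split.
  apply/asboolP; split; last by exists 0 => u v; rewrite dotp0l dotpC dotp0l rmorph0.
  by exists 0; split=> // v; rewrite mul0r vnorm0.
move=> k T U /asboolP[[M [M0 TM]] [T' TT]] /asboolP[[N [N0 UN]] [U' UU]].
apply/asboolP; split.
  exists (normc k * M + N); split; first by rewrite addr_ge0 ?mulr_ge0 ?normc_ge0.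
  move=> v; rewrite (le_trans (ler_vnormD _ _))// mulrDl lerD ?UN//.
  by rewrite vnormZ -mulrA ler_wpM2l ?normc_ge0.
exists ((k^*)%R *: T' + U') => u v.
rewrite -[in LHS]/(k *: T u + U u) -[in RHS]/((k^*)%R *: T' v + U' v).
by rewrite dotpDl dotpDr dotpZl dotpZr TT UU conjCK.
Qed.

HB.instance Definition _ := GRing.isSubmodClosed.Build _ _ bounded_adjointable
  bounded_adjointable_submod.

Record bop := Bop { bop_fun :> V -> V ; bopP : bop_fun \in bounded_adjointable }.

HB.instance Definition _ := [isSub for bop_fun].
HB.instance Definition _ := [Choice of bop by <:].
HB.instance Definition _ := [SubChoice_isSubLmodule of bop by <:].

Implicit Types x y z : bop.

Lemma bop_eqP x y : (forall v, x v = y v) -> x = y.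
Proof. by move=> xy; apply/val_inj/funext. Qed.

Lemma bopD x y v : (x + y) v = x v + y v. Proof. by []. Qed.
Lemma bopB x y v : (x - y) v = x v - y v. Proof. by []. Qed.
Lemma bopZ (k : R[i]) x v : (k *: x) v = k *: x v. Proof. by []. Qed.
Lemma bop_additive x u v : x (u + v) = x u + x v.
Proof.
have /asboolP[_ [x' xx']] := bopP x; apply: dotp_inj => w.
by rewrite xx' !dotpDl !xx'.
Qed.

Lemma bop_scalable x (k : R[i]) v : x (k *: v) = k *: x v.
Proof.
have /asboolP[_ [x' xx']] := bopP x; apply: dotp_inj => w.
by rewrite xx' !dotpZl !xx'.
Qed.

Lemma bop_linear0 x : x 0 = 0.
Proof. by rewrite -(scale0r (0 : V)) bop_scalable !scale0r. Qed.

Lemma adjointC T T' : adjoint T T' -> adjoint T' T.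
Proof. by move=> TT u v; rewrite dotpC -TT -dotpC. Qed.

Lemma adjoint_unique T T1 T2 : adjoint T T1 -> adjoint T T2 -> T1 = T2.
Proof.
move=> T1P T2P; apply/funext => u; apply: dotp_inj => v.
by rewrite (adjointC T1P) (adjointC T2P).
Qed.

(** |T' v|^2 = <T T' v, v> <= M |T' v| |v|. *)
Lemma opbound_adjoint T T' M : adjoint T T' -> opbound T M -> opbound T' M.
Proof.
move=> TT TM v; have [v0|v0] := eqVneq (vnorm (T' v)) 0.
  rewrite v0 (le_trans (vnorm_ge0 (T v)))//; exact: TM.
have {}v0 : 0 < vnorm (T' v) by rewrite lt_def v0 vnorm_ge0.
rewrite -(ler_pM2r v0) -expr2.
have -> : vnorm (T' v) ^+ 2 = normc (dotp (T (T' v)) v).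
  rewrite TT dotpE /= expr0n/= addr0 sqrtr_sqr ger0_norm//.
  exact: sqr_ge0.
rewrite (le_trans (cauchy_schwarz _ _))// mulrAC.
by rewrite ler_wpM2r ?vnorm_ge0.
Qed.

Lemma opstar_subproof x : exists y : bop, adjoint x y.
Proof.
have /asboolP[[M [M0 xM]] [x' xx']] := bopP x.
have x'P : x' \in bounded_adjointable.
  apply/asboolP; split; last by exists x; exact: adjointC.
  by exists M; split=> //; exact: opbound_adjoint xM.
by exists (Bop x'P).
Qed.

Definition opstar x : bop := sval (cid (opstar_subproof x)).

Lemma opstarP x : adjoint x (opstar x).
Proof. exact: svalP (cid (opstar_subproof x)). Qed.

Lemma opstar_eq x y : adjoint x y -> opstar x = y.
Proof. by move=> xy; apply/val_inj; exact: adjoint_unique (opstarP x) xy. Qed.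

Lemma bop1_subproof : @id V \in bounded_adjointable.
Proof.
apply/asboolP; split; last by exists id.
by exists 1; split=> // v; rewrite mul1r.
Qed.

Lemma bopM_subproof x y : x \o y \in bounded_adjointable.
Proof.
have /asboolP[[M [M0 xM]] [x' xx']] := bopP x.
have /asboolP[[N [N0 yN]] [y' yy']] := bopP y.
apply/asboolP; split; last first.
  by exists (y' \o x') => u v /=; rewrite xx' yy'.
exists (M * N); split=> [|v /=]; first exact: mulr_ge0.
by rewrite (le_trans (xM _))// -mulrA ler_wpM2l.
Qed.

Definition bop1 := Bop bop1_subproof.
Definition bop_mul x y := Bop (bopM_subproof x y).

Fact bop_mulA : associative bop_mul.
Proof. by move=> x y z; exact/bop_eqP. Qed.
Fact bop_mul1 : left_id bop1 bop_mul.
Proof. by move=> x; exact/bop_eqP. Qed.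
Fact bop_mulr1 : right_id bop1 bop_mul.
Proof. by move=> x; exact/bop_eqP. Qed.
Fact bop_mulDl : left_distributive bop_mul +%R.
Proof. by move=> x y z; exact/bop_eqP. Qed.
Fact bop_mulDr : right_distributive bop_mul +%R.
Proof. by move=> x y z; apply/bop_eqP => v; exact: bop_additive. Qed.
Fact bop1_neq0 : bop1 != 0.
Proof.
have [v v0] := @preHilbert_neq0 R V; apply: contra_neq v0 => e.
by have : bop1 v = (0 : bop) v by rewrite e.
Qed.

HB.instance Definition _ := GRing.Zmodule_isNzRing.Build bop
  bop_mulA bop_mul1 bop_mulr1 bop_mulDl bop_mulDr bop1_neq0.

Fact bop_scalerAl (k : R[i]) x y : k *: (x * y) = (k *: x) * y.
Proof. exact/bop_eqP. Qed.
Fact bop_scalerAr (k : R[i]) x y : k *: (x * y) = x * (k *: y).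
Proof. by apply/bop_eqP => v; exact/esym/bop_scalable. Qed.

HB.instance Definition _ := GRing.Lmodule_isLalgebra.Build R[i] bop bop_scalerAl.
HB.instance Definition _ := GRing.Lalgebra_isAlgebra.Build R[i] bop bop_scalerAr.

Lemma bop1E v : (1 : bop) v = v. Proof. by []. Qed.
Lemma bopM x y v : (x * y) v = x (y v). Proof. by []. Qed.

Definition opnorm x : R := inf [set M | 0 <= M /\ opbound x M].

Lemma opnorm_le x M : 0 <= M -> opbound x M -> opnorm x <= M.
Proof. by move=> M0 xM; apply: ge_inf => //; exists 0 => N []. Qed.

Lemma opnorm_nonempty x : [set M | 0 <= M /\ opbound x M] !=set0.
Proof. by have /asboolP[[M xM] _] := bopP x; exists M. Qed.

Lemma opnorm_ge0 x : 0 <= opnorm x.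
Proof. by apply: lb_le_inf => [|M []//]; exact: opnorm_nonempty. Qed.

Lemma opnormP x : opbound x (opnorm x).
Proof.
move=> v; have [v0|v0] := eqVneq (vnorm v) 0.
  by rewrite v0 (vnorm_eq0 v0) bop_linear0 vnorm0 mulr0.
have {}v0 : 0 < vnorm v by rewrite lt_def v0 vnorm_ge0.
rewrite -ler_pdivrMr//; apply: lb_le_inf; first exact: opnorm_nonempty.
by move=> M [M0 xM]; rewrite ler_pdivrMr.
Qed.

Fact opstarK : involutive opstar.
Proof. by move=> x; apply: opstar_eq; apply: adjointC; exact: opstarP. Qed.
Fact opstarD : {morph opstar : x y / x + y}.
Proof.
move=> x y; apply: opstar_eq => u v.
rewrite -[in LHS]/(x u + y u) -[in RHS]/(opstar x v + opstar y v).
by rewrite dotpDl dotpDr !opstarP.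
Qed.
Fact opstarZ (k : R[i]) x : opstar (k *: x) = (k^*)%R *: opstar x.
Proof.
apply: opstar_eq => u v.
rewrite -[in LHS]/(k *: x u) -[in RHS]/((k^*)%R *: opstar x v).
by rewrite dotpZl dotpZr conjCK opstarP.
Qed.
Fact opstarM x y : opstar (x * y) = opstar y * opstar x.
Proof. by apply: opstar_eq => u v; rewrite !bopM !opstarP. Qed.

Fact ler_opnormD x y : opnorm (x + y) <= opnorm x + opnorm y.
Proof.
apply: opnorm_le => [|v]; first by rewrite addr_ge0 ?opnorm_ge0.
by rewrite (le_trans (ler_vnormD _ _))// mulrDl lerD// opnormP.
Qed.

Fact ler_opnormM x y : opnorm (x * y) <= opnorm x * opnorm y.
Proof.
apply: opnorm_le => [|v]; first by rewrite mulr_ge0 ?opnorm_ge0.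
by rewrite (le_trans (opnormP x _))// -mulrA ler_wpM2l ?opnorm_ge0 ?opnormP.
Qed.

Fact opnormZ (k : R[i]) x : opnorm (k *: x) = normc k * opnorm x.
Proof.
have key (l : R[i]) y : opnorm (l *: y) <= normc l * opnorm y.
  apply: opnorm_le => [|v]; first by rewrite mulr_ge0 ?normc_ge0 ?opnorm_ge0.
  by rewrite vnormZ -mulrA ler_wpM2l ?normc_ge0 ?opnormP.
apply/eqP; rewrite eq_le key/=.
have [->|k0] := eqVneq k 0; first by rewrite normc0 mul0r opnorm_ge0.
have nk0 : 0 < normc k.
  by rewrite lt_def normc_ge0 andbT; apply: contra_neq k0; exact: eq0_normc.
rewrite -{1}[x]scale1r -(mulVf k0) -scalerA.
rewrite (le_trans (ler_wpM2l (normc_ge0 _) (key _ _)))//.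
by rewrite mulrA normcV// divff ?mul1r ?gt_eqF.
Qed.

(** |x v|^2 = <pstar x x v, v> <= |pstar x x| |v|^2 gives the nontrivial
inequality. *)
Fact opnorm_starM x : opnorm (opstar x * x) = opnorm x ^+ 2.
Proof.
apply/eqP; rewrite eq_le; apply/andP; split.
  rewrite (le_trans (ler_opnormM _ _))// expr2 ler_wpM2r ?opnorm_ge0//.
  apply: opnorm_le; first exact: opnorm_ge0.
  exact: opbound_adjoint (opstarP x) (opnormP x).
rewrite -[leRHS]sqr_sqrtr ?opnorm_ge0// ler_pXn2r ?nnegrE ?opnorm_ge0 ?sqrtr_ge0//.
apply: opnorm_le => [|v]; first exact: sqrtr_ge0.
rewrite -(@ler_pXn2r _ 2)// ?nnegrE ?mulr_ge0 ?sqrtr_ge0 ?vnorm_ge0//.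
rewrite exprMn (sqr_sqrtr (opnorm_ge0 _)).
have -> : vnorm (x v) ^+ 2 = normc (dotp (opstar x (x v)) v).
  rewrite (adjointC (opstarP x)) dotpE /= expr0n/= addr0 sqrtr_sqr ger0_norm//.
  exact: sqr_ge0.
rewrite (le_trans (cauchy_schwarz _ _))// expr2 mulrA ler_wpM2r ?vnorm_ge0//.
exact: (opnormP (opstar x * x) v).
Qed.

HB.instance Definition _ := isPreCstar.Build R bop opstarK opstarD opstarZ
  opstarM ler_opnormD opnormZ ler_opnormM opnorm_starM.

End BoundedOperators.
Arguments bop {R} V.

(** * Finitely supported functions and partial bijections *)

Section FinitelySupported.
Context {R : realType} {I : pointedType}.

Definition finite_support_pred : {pred I -> R[i]} :=
  fun v => `[< finite_set [set i | v i != 0] >].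

Lemma finite_support_submod : submod_closed finite_support_pred.
Proof.
split.
  apply/asboolP; rewrite (_ : [set i | _] = set0) //.
  by apply/seteqP; split=> // i /=; rewrite eqxx.
move=> k u v /asboolP uf /asboolP vf; apply/asboolP.
apply: (@sub_finite_set _ _ ([set i | u i != 0] `|` [set i | v i != 0])).
  move=> i /=; rewrite -[(k *: u + v) i]/(k * u i + v i).
  have [ui0|ui0 _] := eqVneq (u i) 0; last by left.
  by rewrite ui0 mulr0 add0r => vi0; right.
by rewrite finite_setU.
Qed.

HB.instance Definition _ := GRing.isSubmodClosed.Build _ _ finite_support_pred
  finite_support_submod.

Record fsvec := FsVec {
  fsvec_fun :> I -> R[i] ; fsvecP : fsvec_fun \in finite_support_pred }.

HB.instance Definition _ := [isSub for fsvec_fun].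
HB.instance Definition _ := [Choice of fsvec by <:].
HB.instance Definition _ := [SubChoice_isSubLmodule of fsvec by <:].

Implicit Types u v w : fsvec.

Lemma fsvec_eqP u v : (forall i, u i = v i) -> u = v.
Proof. by move=> uv; apply/val_inj/funext. Qed.

Lemma fsvecD u v i : (u + v) i = u i + v i. Proof. by []. Qed.
Lemma fsvecB u v i : (u - v) i = u i - v i. Proof. by []. Qed.
Lemma fsvecZ (k : R[i]) v i : (k *: v) i = k * v i. Proof. by []. Qed.

Lemma fsvec_finite v : finite_set [set i | v i != 0].
Proof. by have /asboolP := fsvecP v. Qed.

Definition fsdot u v : R[i] := \sum_(i \in [set: I]) u i * ((v i)^*)%R.

Lemma fsdotE (D : set I) u v :
  (forall i, u i != 0 -> v i != 0 -> D i) ->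
  fsdot u v = \sum_(i \in D) u i * ((v i)^*)%R.
Proof.
move=> uvD; apply/esym/fsbig_widen => // i [_ Di] /=.
have [->|ui0] := eqVneq (u i) 0; first by rewrite mul0r.
have [->|vi0] := eqVneq (v i) 0; first by rewrite rmorph0 mulr0.
by case: Di; exact: uvD.
Qed.

Fact fsdotDl u v w : fsdot (u + v) w = fsdot u w + fsdot v w.
Proof.
have wf := fsvec_finite w.
rewrite !(@fsdotE [set i | w i != 0])// -fsbig_split//.
by apply: eq_fsbigr => i _; exact: mulrDl.
Qed.
Fact fsdotZl (k : R[i]) u v : fsdot (k *: u) v = k * fsdot u v.
Proof. by rewrite /fsdot mulr_fsumr; apply: eq_fsbigr => i _; rewrite mulrA. Qed.
Fact fsdotC u v : fsdot u v = ((fsdot v u)^*)%R.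
Proof.
have uf := fsvec_finite u.
rewrite !(@fsdotE [set i | u i != 0])// !fsbig_finite// rmorph_sum.
by apply: eq_bigr => i _; rewrite -[in LHS](conjCK (u i)) -rmorphM [_ * v i]mulrC.
Qed.
Fact fsdot_ge0 v : 0 <= fsdot v v.
Proof. by apply: fsumr_ge0 => i _; rewrite -normCK exprn_ge0. Qed.
Fact fsdot_eq0 v : fsdot v v = 0 -> v = 0.
Proof.
have vf := fsvec_finite v.
rewrite (@fsdotE [set i | v i != 0])// fsbig_finite// => v0.
apply/fsvec_eqP => i; have [//|vi0] := eqVneq (v i) 0; exfalso.
move/eqP: v0; rewrite psumr_eq0 => [|j _]; last by rewrite -normCK exprn_ge0.
move/allP/(_ i); rewrite in_fset_set// inE /= vi0 => /(_ isT).
by rewrite mulf_eq0 conjC_eq0 orbb (negPf vi0).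
Qed.

Lemma fsdelta_subproof (i : I) :
  (fun j => (j == i)%:R) \in finite_support_pred.
Proof.
apply/asboolP; apply: (sub_finite_set _ (finite_set1 i)) => j /=.
by have [->//|_] := eqVneq j i; rewrite eqxx.
Qed.
Definition fsdelta i := FsVec (fsdelta_subproof i).

Lemma fsdelta_neq0 i : fsdelta i != 0.
Proof.
apply/eqP => /(congr1 (fun v : fsvec => v i)) /=.
by rewrite eqxx => /eqP; rewrite oner_eq0.
Qed.

Fact fsvec_neq0 : exists v, v != 0.
Proof. by exists (fsdelta point); exact: fsdelta_neq0. Qed.

HB.instance Definition _ := isPreHilbert.Build R fsvec
  fsdotDl fsdotZl fsdotC fsdot_ge0 fsdot_eq0 fsvec_neq0.

Lemma vnorm_le_dotp (u v : fsvec) (M : R) : 0 <= M ->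
  dotp u u <= (M ^+ 2)%:C * dotp v v -> vnorm u <= M * vnorm v.
Proof.
move=> M0; rewrite !dotpE -rmorphM lecR -exprMn.
by rewrite ler_pXn2r ?nnegrE ?mulr_ge0 ?vnorm_ge0.
Qed.

Lemma opnorm_diag (x : bop fsvec) (f : I -> R[i]) (M : R) : 0 <= M ->
  (forall v i, x v i = f i * v i) -> (forall i, normc (f i) <= M) ->
  pnorm x <= M.
Proof.
move=> M0 xf fM; apply: opnorm_le => // v; apply: vnorm_le_dotp => //.
have vf := fsvec_finite v.
rewrite [leLHS](@fsdotE [set i | v i != 0])//; last first.
  by move=> i _ +; rewrite xf mulf_eq0 negb_or => /andP[].
rewrite [dotp v v](@fsdotE [set i | v i != 0])// !fsbig_finite// mulr_sumr.
apply: ler_sum => i _; rewrite -!normCK xf normrM exprMn ler_wpM2r ?exprn_ge0//.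
by rewrite -sqr_normcC lecR ler_pXn2r ?nnegrE ?normc_ge0.
Qed.

Section PartialBijection.
Variables (P Q : pred I) (h g : I -> I).
Hypothesis hP : forall i, P i -> Q (h i).
Hypothesis gQ : forall j, Q j -> P (g j).
Hypothesis hK : forall i, P i -> g (h i) = i.
Hypothesis gK : forall j, Q j -> h (g j) = j.

(** Composition with a partial bijection h from P to Q, of inverse g, extended
by zero: a partial isometry. *)
Definition pbij_fun (v : fsvec) : I -> R[i] := fun i => if P i then v (h i) else 0.

Lemma pbij_supp v : pbij_fun v \in finite_support_pred.
Proof.
apply/asboolP; apply: (sub_finite_set _ (finite_image g (fsvec_finite v))).
move=> i /=; rewrite /pbij_fun; case: ifPn => [Pi vhi|_]; last by rewrite eqxx.
by exists (h i) => //; rewrite hK.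
Qed.

Definition pbij v : fsvec := FsVec (pbij_supp v).

Lemma dotp_pbij u v :
  dotp (pbij u) v = \sum_(j \in [set j | Q j]) u j * ((v (g j))^*)%R.
Proof.
rewrite [LHS](@fsdotE [set i | P i]); last first.
  by move=> i + _; rewrite /= /pbij_fun; case: ifP => //; rewrite eqxx.
rewrite [RHS](reindex_fsbig h [set i | P i]); last first.
  split=> [i /= /hP//|i j /= |j /= Qj].
    by rewrite !inE => Pi Pj hij; rewrite -(hK Pi) hij hK.
  by exists (g j); [exact: gQ|exact: gK].
apply: eq_fsbigr => i; rewrite inE /= /pbij_fun => Pi.
by rewrite Pi hK.
Qed.

Lemma pbij_bound : opbound pbij 1.
Proof.
move=> v; apply: vnorm_le_dotp => //.
rewrite expr1n mul1r dotp_pbij.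
have vf := fsvec_finite v.
rewrite [leRHS](@fsdotE [set i | v i != 0])//.
rewrite (fsbigID [set j | Q j] _ _ vf) /=.
rewrite (_ : \sum_(j \in [set j | Q j]) _ =
    \sum_(i \in [set i | v i != 0] `&` [set j | Q j]) v i * ((v i)^*)%R).
  by rewrite lerDl; apply: fsumr_ge0 => i _; rewrite -normCK exprn_ge0.
rewrite [RHS](fsbig_widen _ [set j | Q j]); last 2 first.
- by move=> i [].
- move=> i [/= Qi /not_andP[|//]] /negP; rewrite negbK => /eqP ->.
  by rewrite mul0r.
by apply: eq_fsbigr => j; rewrite inE /= => Qj; rewrite /pbij_fun gQ// gK.
Qed.

End PartialBijection.

Lemma pbij_adjoint (P Q : pred I) (h g : I -> I) :
  (forall i, P i -> Q (h i)) -> (forall j, Q j -> P (g j)) ->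
  forall (hK : forall i, P i -> g (h i) = i) (gK : forall j, Q j -> h (g j) = j),
  adjoint (pbij hK) (pbij gK).
Proof.
move=> hP gQ hK gK u v; rewrite (dotp_pbij hP gQ hK gK).
rewrite [RHS](@fsdotE [set j | Q j]); last first.
  by move=> j _; rewrite /= /pbij_fun; case: ifP => //; rewrite eqxx.
by apply: eq_fsbigr => j; rewrite inE /= /pbij_fun => ->.
Qed.

End FinitelySupported.
Arguments fsvec R I : clear implicits.

(** * Matrix units on configurations of points *)

Section MatrixUnits.
Context {R : realType}.
Local Open Scope fset_scope.
Local Open Scope ring_scope.
Local Notation I := {fset R}.
Implicit Types (t u : R) (w S U : I).

HB.instance Definition _ := isPointed.Build {fset R} fset0.

Local Notation V := (fsvec R {fset R}).

(** The window ]0, t] starts at 0 so that munit 0 is the identity. *)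
Definition lo t w : I := [fset s in w | 0 < s <= t].
Definition hi t w : I := [fset s in w | ~~ (0 < s <= t)].

Lemma in_lo t w s : (s \in lo t w) = (s \in w) && (0 < s <= t).
Proof. by rewrite !inE. Qed.
Lemma in_hi t w s : (s \in hi t w) = (s \in w) && ~~ (0 < s <= t).
Proof. by rewrite !inE. Qed.

Definition splice t S w : I := lo t S `|` hi t w.

Lemma in_splice t S w s :
  (s \in splice t S w) = if 0 < s <= t then s \in S else s \in w.
Proof. by rewrite in_fsetU in_lo in_hi; case: ifP; rewrite ?andbT ?andbF ?orbF. Qed.

Lemma lo_splice t S w : lo t (splice t S w) = lo t S.
Proof.
by apply/fsetP => s; rewrite !in_lo in_splice; case: ifP; rewrite ?andbF.
Qed.

Lemma splice_lo t S w : lo t w = lo t S -> splice t S w = w.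
Proof.
move=> /fsetP wS; apply/fsetP => s; rewrite in_splice; case: ifP => // st.
by have := wS s; rewrite !in_lo st !andbT.
Qed.

Lemma spliceK t S S' w : lo t w == lo t S -> splice t S (splice t S' w) = w.
Proof.
move=> /eqP /fsetP wS; apply/fsetP => s; rewrite !in_splice.
case: (boolP (0 < s <= t)) => // st.
by have := wS s; rewrite !in_lo st !andbT.
Qed.

Lemma munit_subproof t S S' :
  (pbij (@spliceK t S S') : V -> V) \in bounded_adjointable.
Proof.
apply/asboolP; split; last first.
  by exists (pbij (@spliceK t S' S)); apply: pbij_adjoint => w _; rewrite lo_splice.
exists 1; split=> //.
by apply: pbij_bound (@spliceK t S' S) => w _; rewrite lo_splice.
Qed.

Definition munit t S S' : bop V := Bop (munit_subproof t S S').

Lemma munitE t S S' (v : V) w :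
  munit t S S' v w = if lo t w == lo t S then v (splice t S' w) else 0.
Proof. by []. Qed.

Lemma bopV_eqP (x y : bop V) : (forall v w, x v w = y v w) -> x = y.
Proof. by move=> xy; apply/bop_eqP => v; apply/fsvec_eqP. Qed.

Lemma munit_star t S S' : pstar (munit t S S') = munit t S' S.
Proof. by apply: opstar_eq; apply: pbij_adjoint => w _; rewrite lo_splice. Qed.

Lemma munit0 S S' : munit 0 S S' = 1.
Proof.
apply: bopV_eqP => v w; rewrite munitE.
have l0 A : lo 0 A = fset0.
  apply/fsetP => s; rewrite in_lo in_fset0.
  by apply/negP => /and3P[_ /lt_le_trans h /h]; rewrite ltxx.
rewrite !l0 eqxx splice_lo// !l0//.
Qed.

(** The second factor prescribes the window ]0, u].  The first one prescribes
]0, t] and requires what it leaves there, S', to agree with U; on ]t, u] the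
requirement U is met by the argument itself. *)
Lemma munit_mul_le t u S S' U U' : t <= u ->
  munit t S S' * munit u U U' =
  if lo t S' == lo t U then munit u (splice t S U) U' else 0.
Proof.
move=> tu; apply: bopV_eqP => v w; rewrite bopM munitE [munit u U U' v _]munitE.
have tuP s : 0 < s <= t -> 0 < s <= u by move=> /andP[-> /le_trans]; apply.
have gg : splice u U' (splice t S' w) = splice u U' w.
  apply/fsetP => s; rewrite !in_splice; case: ifP => //= su; case: ifP => // st.
  by rewrite tuP in su.
rewrite gg [RHS](_ : _ = if (lo t S' == lo t U) && (lo u w == lo u (splice t S U))
   then v (splice u U' w) else 0); last first.
  by case: ifP => //= _; rewrite munitE.
have -> : (lo t S' == lo t U) && (lo u w == lo u (splice t S U)) =
   (lo t w == lo t S) && (lo u (splice t S' w) == lo u U).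
  apply/andP/andP => -[/eqP/fsetP h1 /eqP/fsetP h2]; split; apply/eqP/fsetP => s.
  - have := h2 s; rewrite !in_lo in_splice; case: (boolP (0 < s <= t)) => st.
      by rewrite (tuP _ st) !andbT.
    by rewrite !andbF.
  - have := h2 s; have := h1 s; rewrite !in_lo !in_splice.
    by case: (boolP (0 < s <= t)) => st; rewrite ?(tuP _ st) ?andbT.
  - have := h2 s; rewrite !in_lo in_splice; case: (boolP (0 < s <= t)) => st.
      by rewrite (tuP _ st) !andbT.
    by rewrite !andbF.
  - have := h2 s; have := h1 s; rewrite !in_lo !in_splice.
    by case: (boolP (0 < s <= t)) => st; rewrite ?(tuP _ st) ?andbT.
by case: eqP.
Qed.

Lemma munit_mul_ge t u S S' U U' : u <= t ->
  munit t S S' * munit u U U' =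
  if lo u S' == lo u U then munit t S (splice u U' S') else 0.
Proof.
move=> ut; rewrite -[LHS]pstarK pstarM !munit_star munit_mul_le//.
by rewrite (eq_sym (lo u S')); case: ifP => _; rewrite ?munit_star ?pstar0.
Qed.

(** Powers of 4 make the grids nested and the square root of their cardinal an
integer. *)
Definition grid k : I := [fset j.+1%:R / (4 ^ k)%:R | j in iota 0 (4 ^ k)].

Definition units_of (F : I) : seq (bop V) :=
  [seq munit t p.1 p.2 | t <- 0 :: F,
    p <- [seq (A, B) | A <- fpowerset F, B <- fpowerset F]].

Lemma units_ofP (F : I) t S S' : t \in (0 : R) |` F -> S `<=` F -> S' `<=` F ->
  munit t S S' \in units_of F.
Proof.
move=> tF SF S'F; apply/allpairsP; exists (t, (S, S')); split=> //=.
  by rewrite inE -in_fset1U.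
by apply/allpairsP; exists (S, S'); split; rewrite ?fpowersetE.
Qed.

Lemma units_of_ind (F : I) (P : bop V -> Prop) :
  (forall t S S', t \in (0 : R) |` F -> S `<=` F -> S' `<=` F ->
    P (munit t S S')) -> forall x, x \in units_of F -> P x.
Proof.
move=> FP x /allpairsP[[t p] /= [tF /allpairsP[[S S'] /= [SF S'F ->]] ->]].
by apply: FP; rewrite ?inE -?fpowersetE// -in_cons.
Qed.

Lemma splice_sub t S U (F : I) : S `<=` F -> U `<=` F -> splice t S U `<=` F.
Proof.
move=> /fsubsetP SF /fsubsetP UF; apply/fsubsetP => s; rewrite in_splice.
by case: ifP => _; [exact: SF|exact: UF].
Qed.

Lemma units_of_mul F : {in units_of F &, forall x y, lin_span (units_of F) (x * y)}.
Proof.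
move=> x y; move: x; apply: units_of_ind => t S S' tF SF S'F.
move: y; apply: units_of_ind => u U U' uF UF U'F.
have [tu|/ltW ut] := leP t u.
  rewrite munit_mul_le//; case: ifP => _; last exact: span0.
  by apply/mem_span/units_ofP => //; exact: splice_sub.
rewrite munit_mul_ge//; case: ifP => _; last exact: span0.
by apply/mem_span/units_ofP => //; exact: splice_sub.
Qed.

Lemma units_of_star F : {in units_of F, forall x, lin_span (units_of F) (pstar x)}.
Proof.
apply: units_of_ind => t S S' tF SF S'F; rewrite munit_star.
by apply/mem_span/units_ofP.
Qed.

Lemma units_of_sub (F G : I) : F `<=` G -> {subset units_of F <= units_of G}.
Proof.
move=> FG; apply: units_of_ind => t S S' tF SF S'F; apply: units_ofP.
- by move: tF; rewrite !inE => /orP[->//|/(fsubsetP FG) ->]; rewrite orbT.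
- exact: fsubset_trans FG.
- exact: fsubset_trans FG.
Qed.

Lemma gridP k t :
  reflect (exists2 j, (j < 4 ^ k)%N & t = j.+1%:R / (4 ^ k)%:R) (t \in grid k).
Proof.
apply: (iffP (imfsetP _ _ _ _)) => /= [[j jk ->]|[j jk ->]]; exists j => //; move: jk.
  by rewrite mem_iota.
by rewrite mem_iota.
Qed.

Lemma grid_incr k : grid k `<=` grid k.+1.
Proof.
apply/fsubsetP => t /gridP[j jk ->]; apply/gridP; exists (4 * j + 3)%N.
  by rewrite expnS; lia.
rewrite expnS (_ : (4 * j + 3).+1 = 4 * j.+1)%N; last by lia.
by rewrite !natrM -mulf_div divff// mul1r.
Qed.

End MatrixUnits.

(** * Nilpotent approximation of sums of projections *)

Section NilpotentSum.
Context {D : nzRingType}.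

(** Expanding (a + b)^n, only the words with at most one letter b survive. *)
Lemma exprD_sandwich (a b : D) n : (forall i, b * a ^+ i * b = 0) ->
  (a + b) ^+ n = a ^+ n + \sum_(i < n) a ^+ i * b * a ^+ (n.-1 - i).
Proof.
move=> bab; elim: n => [|n ih]; first by rewrite big_ord0 addr0.
have bS : b * (\sum_(i < n) a ^+ i * b * a ^+ (n.-1 - i)) = 0.
  by rewrite mulr_sumr big1// => i _; rewrite !mulrA bab mul0r.
rewrite exprS ih mulrDl !mulrDr bS addr0 -exprS -addrA; congr (_ + _).
rewrite big_ord_recl expr0 mul1r subn0 addrC mulr_sumr; congr (_ + _).
apply: eq_bigr => -[i /= ni] _; rewrite /bump/= add1n exprS !mulrA.
by congr (_ * a ^+ _); lia.
Qed.

Lemma nilpotent_add (a b : D) m : (forall i, b * a ^+ i * b = 0) -> a ^+ m = 0 ->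
  (a + b) ^+ (m.+1 + m.+1) = 0.
Proof.
move=> bab am.
have am' i : (m <= i)%N -> a ^+ i = 0 by move=> /subnK <-; rewrite exprD am mulr0.
rewrite exprD_sandwich// am' ?add0r; last by lia.
(* one of the two powers of a around b has exponent at least m *)
apply: big1 => -[i /= _] _; case: (leqP m i) => mi; first by rewrite am' ?mul0r.
by rewrite [X in _ * X]am' ?mulr0//; lia.
Qed.

End NilpotentSum.

Section Nilpotent.
Context {R : realType}.
Local Open Scope fset_scope.
Local Open Scope ring_scope.
Local Notation V := (fsvec R {fset R}).
Implicit Types (t s : R) (w : {fset R}) (v : V).

(** The projection onto the functions carried by the w without points in ]0, t]. *)
Definition emptyp t : bop V := munit t fset0 fset0.
(** The partial isometry that adds the point t to the sets w without points in
]0, t]. *)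
Definition insertp t : bop V := munit t [fset t] fset0.

Lemma munit_lo t S U S' : lo t S = lo t U -> munit t S S' = munit t U S' :> bop V.
Proof. by move=> SU; apply: bopV_eqP => v w; rewrite !munitE SU. Qed.

Lemma lo0 t : lo t (fset0 : {fset R}) = fset0.
Proof. by apply/fsetP => s; rewrite in_lo !in_fset0. Qed.

Lemma lo1 t s : lo t [fset s] = if 0 < s <= t then [fset s] else fset0.
Proof.
apply/fsetP => r; rewrite in_lo in_fset1; case: eqVneq => [->|rs] /=.
  by case: ifP; rewrite ?in_fset1 ?eqxx ?in_fset0.
by case: ifP; rewrite ?in_fset1 ?(negPf rs) ?in_fset0.
Qed.

Lemma splice0 t w : splice t fset0 w = hi t w.
Proof. by rewrite /splice lo0 fset0U. Qed.

Lemma splice1 t w : 0 < t -> splice t [fset t] w = t |` hi t w.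
Proof. by move=> t0; rewrite /splice lo1 t0 lexx. Qed.

Lemma hi_hi t w : hi t (hi t w) = hi t w.
Proof. by apply/fsetP => s; rewrite !in_hi -andbA andbb. Qed.

Lemma emptyp_star t : pstar (emptyp t) = emptyp t.
Proof. exact: munit_star. Qed.

Lemma emptyp_idem t : emptyp t * emptyp t = emptyp t.
Proof.
rewrite munit_mul_le// eqxx; apply: munit_lo; exact: lo_splice.
Qed.

(** The sets produced by insertp t have t as their first point, so different
points give orthogonal ranges. *)
Lemma insertp_starM t s : 0 < t -> 0 < s ->
  pstar (insertp t) * insertp s = if t == s then emptyp t else 0.
Proof.
have lt_case (x y : R) : 0 < x -> x < y -> pstar (insertp x) * insertp y = 0.
  move=> x0 xy; rewrite munit_star munit_mul_le ?ltW// !lo1 x0 lexx.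
  rewrite (lt_trans x0 xy) leNgt xy/=.
  by case: eqP => // /fsetP/(_ x); rewrite in_fset1 eqxx in_fset0.
move=> t0 s0; case: (ltgtP t s) => [ts|st|<-]; first exact: lt_case.
  by rewrite -[LHS]pstarK pstarM pstarK lt_case// pstar0.
rewrite munit_star munit_mul_le// eqxx; apply: munit_lo; exact: lo_splice.
Qed.

Lemma insertp_emptyp t : insertp t * emptyp t = insertp t.
Proof.
by rewrite munit_mul_le// eqxx; apply: munit_lo; rewrite lo_splice.
Qed.

(** In the coordinate [t in w] this is the matrix with rows (1, -1) and (1, -1),
tensored with the projection onto the empty configuration before t and with the
identity after t. *)
Definition nilpart t : bop V :=
  emptyp t - insertp t * pstar (insertp t) - pstar (insertp t) + insertp t.

(** In this form the value at w visibly does not depend on whether t is in w. *)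
Lemma nilpartE t v w : 0 < t -> nilpart t v w =
  if lo t w `<=` [fset t] then v (hi t w) - v (t |` hi t w) else 0.
Proof.
move=> t0.
rewrite /nilpart bopD fsvecD !bopB !fsvecB.
rewrite munit_star bopM !munitE lo_splice lo0 lo1 t0 lexx eqxx fsubset1.
have gg : splice t [fset t] (splice t fset0 w) = t |` hi t w.
  by rewrite splice1// splice0 hi_hi.
rewrite gg splice1// splice0.
have [->|_] := eqVneq (lo t w) [fset t]; last first.
  by case: eqVneq => _ /=; rewrite ?subr0 ?addr0 ?sub0r// oppr0.
have -> : [fset t] == fset0 :> {fset R} = false.
  by apply/eqP => /fsetP/(_ t); rewrite in_fset1 eqxx in_fset0.
by rewrite /= subr0 sub0r addrC.
Qed.

Definition independent t v := forall w, v (t |` w) = v (w `\ t).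

Lemma independent_nilpart t v : 0 < t -> independent t (nilpart t v).
Proof.
move=> t0 w; rewrite !nilpartE//.
have -> : hi t (t |` w) = hi t (w `\ t).
  apply/fsetP => s; rewrite !in_hi in_fset1U in_fsetD1.
  by case: eqVneq => [->|]//=; rewrite t0 lexx.
congr (if _ then _ else _); apply/fsubsetP/fsubsetP => h s; have := h s;
  rewrite !in_lo in_fset1U in_fsetD1 in_fset1; by case: (s == t).
Qed.

Lemma nilpart_independent t v : 0 < t -> independent t v -> nilpart t v = 0.
Proof.
move=> t0 vt; apply/fsvec_eqP => w; rewrite nilpartE//; case: ifP => // _.
rewrite vt (_ : hi t w `\ t = hi t w) ?subrr//.
apply/fsetP => s; rewrite in_fsetD1 in_hi; case: eqVneq => // ->.
by rewrite t0 lexx andbF.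
Qed.

Lemma independent_lt s t v : 0 < s -> s < t -> independent t v ->
  independent t (nilpart s v).
Proof.
move=> s0 st vt w; rewrite !nilpartE//.
have ts : 0 < t <= s = false by rewrite [t <= s]leNgt st andbF.
have -> : lo s (t |` w) = lo s (w `\ t).
  apply/fsetP => r; rewrite !in_lo in_fset1U in_fsetD1.
  by case: eqVneq => [->|]//=; rewrite ts andbF.
have hU : hi s (t |` w) = t |` hi s w.
  apply/fsetP => r; rewrite !in_fset1U !in_hi in_fset1U.
  by case: eqVneq => [->|]//=; rewrite ts.
have hD : hi s (w `\ t) = hi s w `\ t.
  by apply/fsetP => r; rewrite !in_fsetD1 !in_hi in_fsetD1 andbA.
rewrite hU hD fsetUCA !vt; congr (if _ then _ - v _ else _).
apply/fsetP => r; rewrite in_fsetD1 !in_fset1U in_fsetD1.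
by case: (eqVneq r s) => [->|]//=; rewrite lt_eqF.
Qed.

Lemma independentD t (u v : V) :
  independent t u -> independent t v -> independent t (u + v).
Proof. by move=> ut vt w; rewrite !fsvecD ut vt. Qed.

Lemma sum_nilpartS (s : nat -> R) n : (\sum_(i < n.+1) nilpart (s i) : bop V) =
  \sum_(i < n) nilpart (s i) + nilpart (s n).
Proof. by rewrite big_ord_recr. Qed.

Lemma independent_sum t (s : nat -> R) n v : (forall i, 0 < s i) ->
  (forall i, (i < n)%N -> s i < t) ->
  independent t v -> independent t ((\sum_(i < n) nilpart (s i) : bop V) v).
Proof.
move=> s0; elim: n => [|n ih] st vt; first by rewrite big_ord0.
rewrite sum_nilpartS bopD; apply: independentD.
  by apply: ih => // i /ltnW; exact: st.
exact: independent_lt (s0 n) (st n (ltnSn n)) vt.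
Qed.

(** Triangularity: the last term b has its range in the functions that do not
depend on the last point, the earlier terms preserve these functions, and b kills
them.  So b a^i b = 0 for the sum a of the earlier terms. *)
Lemma sum_nilpart_nilpotent (s : nat -> R) n : (forall i, 0 < s i) ->
  (forall i j, (i < j)%N -> s i < s j) ->
  exists m, (\sum_(i < n) nilpart (s i) : bop V) ^+ m = 0.
Proof.
move=> s0 sinc; elim: n => [|n [m ih]]; first by exists 1%N; rewrite big_ord0 expr1.
exists (m.+1 + m.+1)%N; rewrite sum_nilpartS; apply: nilpotent_add => // i.
apply/bop_eqP => v; rewrite -mulrA !bopM -[RHS]/(0 : V).
apply: nilpart_independent => //.
elim: i => [|i ihi]; first by rewrite expr0 bop1E; exact: independent_nilpart.
by rewrite exprS bopM; apply: independent_sum => // j; exact: sinc.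
Qed.

(** For the sum X on the left, pstar X * X is a sum of n projections, because the
ranges of the summands are orthogonal. *)
Lemma opnorm_sum_insertp (s : nat -> R) n : (forall i, 0 < s i) -> injective s ->
  pnorm (\sum_(i < n) insertp (s i) : bop V) ^+ 2 <= n%:R.
Proof.
move=> s0 sinj; rewrite -pnorm_pstarM pstar_sum.
have -> : (\sum_(i < n) pstar (insertp (s i))) * (\sum_(i < n) insertp (s i)) =
    \sum_(i < n) emptyp (s i) :> bop V.
  rewrite mulr_suml; apply: eq_bigr => i _; rewrite mulr_sumr (bigD1 i)//= big1.
    by rewrite insertp_starM// eqxx addr0.
  by move=> j ji; rewrite insertp_starM// inj_eq// val_eqE eq_sym (negPf ji).
rewrite (le_trans (ler_pnorm_sum _ _ _))// -[n in leRHS]card_ord -sum1_card natr_sum.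
apply: ler_sum => i _; apply: pnorm_projection; first exact: emptyp_star.
exact: emptyp_idem.
Qed.

(** A sum of orthogonal projections. *)
Lemma opnorm_sum_range (s : nat -> R) n : (forall i, 0 < s i) -> injective s ->
  pnorm (\sum_(i < n) insertp (s i) * pstar (insertp (s i)) : bop V) <= 1.
Proof.
move=> s0 sinj; apply: pnorm_projection.
  by rewrite pstar_sum; apply: eq_bigr => i _; rewrite pstarM pstarK.
rewrite mulr_suml; apply: eq_bigr => i _; rewrite mulr_sumr (bigD1 i)//= big1.
  rewrite addr0 mulrA -[_ * pstar (insertp _) * insertp _]mulrA insertp_starM// eqxx.
  by rewrite insertp_emptyp.
move=> j ji; rewrite mulrA -[_ * pstar (insertp _) * insertp _]mulrA insertp_starM//.
by rewrite inj_eq// val_eqE eq_sym (negPf ji) mulr0 mul0r.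
Qed.

(** The difference of the two sums is C + pstar X - X for the projection C of
opnorm_sum_range and the operator X of opnorm_sum_insertp, of norm at most 2^k. *)
Lemma opnorm_emptyp_nilpart (s : nat -> R) k : (forall i, 0 < s i) -> injective s ->
  pnorm (\sum_(i < 4 ^ k) emptyp (s i) - \sum_(i < 4 ^ k) nilpart (s i) : bop V)
    <= 3 * 2 ^+ k.
Proof.
move=> s0 sinj; pose sh : bop V := \sum_(i < 4 ^ k) insertp (s i).
have shk : pnorm sh <= 2 ^+ k.
  rewrite -(@ler_pXn2r _ 2)// ?nnegrE ?pnorm_ge0 ?exprn_ge0//.
  rewrite (le_trans (opnorm_sum_insertp _ s0 sinj))//.
  by rewrite natrX -exprM mulnC exprM expr2 -natrM.
have -> : \sum_(i < 4 ^ k) emptyp (s i) - \sum_(i < 4 ^ k) nilpart (s i) =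
   \sum_(i < 4 ^ k) insertp (s i) * pstar (insertp (s i)) + (pstar sh - sh) :> bop V.
  rewrite pstar_sum -!sumrB -big_split/=; apply: eq_bigr => i _.
  by rewrite /nilpart -!addrA opprD addNKr !opprD !opprK.
rewrite (le_trans (ler_pnormD _ _))//.
have -> : 3 * 2 ^+ k = 2 ^+ k + (2 ^+ k + 2 ^+ k) :> R by ring.
rewrite lerD//; last first.
  by rewrite (le_trans (ler_pnormB _ _))// pnorm_pstar lerD.
by rewrite (le_trans (opnorm_sum_range _ s0 sinj))// exprn_ege1// ler1n.
Qed.

End Nilpotent.

(** * The positive element and its resolvents *)

Section ThresholdCount.

Lemma threshold_count (b : nat -> bool) n : (forall j, b j.+1 -> b j) ->
  exists2 c, (c <= n)%N & (forall j, (j < n)%N -> b j = (j < c)%N).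
Proof.
move=> bdec; have bS i d : b (i + d)%N -> b i.
  by elim: d => [|d ih]; rewrite ?addn0 ?addnS// => /bdec.
elim: n => [|n [c cn hc]]; first by exists 0%N.
have [bn|bn] := boolP (b n).
  exists n.+1 => // j; rewrite ltnS => jn; rewrite jn.
  by apply: (bS _ (n - j)%N); rewrite subnKC.
exists c => [|j]; first exact: leqW.
rewrite ltnS leq_eqVlt => /predU1P[->|]; last exact: hc.
by rewrite (negPf bn) ltnNge cn.
Qed.

(** Summation by parts: a function of the threshold c is a linear combination of
the indicators of j < c.  This puts functions of the staircase in the span of
the projections emptyp. *)
Lemma sum_threshold (D : zmodType) (f : nat -> D) (n c : nat) : (c <= n)%N ->
  \sum_(j < n) (f j.+1 - f j) *+ (j < c)%N = f c - f 0%N.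
Proof.
move=> cn; rewrite -(telescope_sumr f (leq0n c)) -(subnKC cn) big_split_ord/=.
rewrite [X in _ + X]big1 ?addr0 => [|i _]; last by rewrite ltnNge leq_addr.
by rewrite big_mkord; apply: eq_bigr => i _; rewrite ltn_ord.
Qed.

End ThresholdCount.

Section Construction.
Context {R : realType}.
Local Open Scope fset_scope.
Local Open Scope ring_scope.
Local Notation V := (fsvec R {fset R}).
Implicit Types (w : {fset R}) (v : V).

Definition grid_subalgebra := span_union_sub
  (fun k => @units_of_sub R _ _ (grid_incr k))
  (fun k => @units_of_mul R (grid k)) (fun k => @units_of_star R (grid k)).

Definition grid_point k (j : nat) : R := j.+1%:R / (4 ^ k)%:R.

Lemma grid_point_gt0 k j : 0 < grid_point k j.
Proof. by rewrite divr_gt0// ltr0n expn_gt0. Qed.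

Lemma grid_point_lt k i j : (i < j)%N -> grid_point k i < grid_point k j.
Proof. by move=> ij; rewrite ltr_pM2r ?ltr_nat// invr_gt0 ltr0n expn_gt0. Qed.

Lemma grid_point_inj k : injective (grid_point k).
Proof.
move=> i j ij; case: (ltngtP i j) => // /(@grid_point_lt k); by rewrite ij ltxx.
Qed.

Lemma grid_point_in k j : (j < 4 ^ k)%N -> grid_point k j \in grid k.
Proof. by move=> jk; apply/gridP; exists j. Qed.

Lemma munit_in k t (S U : {fset R}) : t \in (0 : R) |` grid k ->
  S `<=` grid k -> U `<=` grid k -> lin_span (units_of (grid k)) (munit t S U).
Proof. by move=> tk Sk Uk; apply/mem_span/units_ofP. Qed.

Lemma emptyp_in k j :
  (j < 4 ^ k)%N -> lin_span (units_of (grid k)) (emptyp (grid_point k j)).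
Proof.
by move=> jk; apply: munit_in; rewrite ?fsub0set// in_fset1U grid_point_in ?orbT.
Qed.

Lemma insertp_in k j :
  (j < 4 ^ k)%N -> lin_span (units_of (grid k)) (insertp (grid_point k j)).
Proof.
by move=> jk; apply: munit_in; rewrite ?fsub0set ?fsub1set ?in_fset1U ?grid_point_in ?orbT.
Qed.

Lemma nilpart_in k j :
  (j < 4 ^ k)%N -> lin_span (units_of (grid k)) (nilpart (grid_point k j)).
Proof.
move=> jk; have sj := insertp_in jk.
have aj := span_star (@units_of_star R (grid k)) sj.
apply: spanD => //; apply: spanB => //; apply: spanB; first exact: emptyp_in.
exact: (span_mul (@units_of_mul R (grid k))).
Qed.

Lemma in_grid_subalgebra k x :
  lin_span (units_of (grid k)) x -> carrier grid_subalgebra x.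
Proof. by move=> xk; exists k. Qed.

(** The eigenvalue of stair k at w. *)
Definition height k w : R :=
  (\sum_(j < 4 ^ k) (lo (grid_point k j) w == fset0 : nat))%:R / (4 ^ k)%:R.

Lemma lo_le0 (t s : R) w : s <= t -> lo t w = fset0 -> lo s w = fset0.
Proof.
move=> st /fsetP tw; apply/fsetP => r; have := tw r; rewrite !in_lo !in_fset0.
case: (r \in w) => //=; case: (0 < r) => //= /negbT.
by rewrite -ltNge => /(le_lt_trans st) h; rewrite leNgt h.
Qed.

Lemma lo_threshold k w : exists2 c, (c <= 4 ^ k)%N &
  forall j, (j < 4 ^ k)%N -> (lo (grid_point k j) w == fset0) = (j < c)%N.
Proof.
apply: threshold_count => j /eqP h; apply/eqP; apply: lo_le0 h.
by rewrite ltW// grid_point_lt.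
Qed.

Lemma heightE k w c : (c <= 4 ^ k)%N ->
  (forall j, (j < 4 ^ k)%N -> (lo (grid_point k j) w == fset0) = (j < c)%N) ->
  height k w = c%:R / (4 ^ k)%:R.
Proof.
move=> ck hc; congr (_%:R / _).
rewrite (eq_bigr (fun j : 'I_(4 ^ k) => (j < c)%N : nat)); last first.
  by move=> j _; rewrite hc.
rewrite -(subnKC ck) big_split_ord/= [X in (_ + X)%N]big1 ?addn0; last first.
  by move=> i _; rewrite ltnNge leq_addr.
by rewrite (eq_bigr (fun=> 1%N)) ?sum1_card ?card_ord// => i _; rewrite ltn_ord.
Qed.

(** The first point of w in ]0, 1], or 1 if there is none: the window ]0, t] is
empty exactly when t is smaller. *)
Definition first_point w : R := sup [set t : R | 0 <= t <= 1 /\ lo t w = fset0].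

(** If c of the 4^k windows are empty, then the first point of w lies between the
grid points c / 4^k and (c + 1) / 4^k. *)
Lemma height_first_point k w : `|first_point w - height k w| <= (4 ^ k)%:R^-1.
Proof.
have [c ck hc] := lo_threshold k w; rewrite (heightE ck hc).
have L0 : 0 < (4 ^ k)%:R :> R by rewrite ltr0n expn_gt0.
have E0 : [set t : R | 0 <= t <= 1 /\ lo t w = fset0] 0.
  split; first by rewrite lexx ler01.
  apply/fsetP => s; rewrite in_lo in_fset0.
  by apply/negP => /and3P[_ /lt_le_trans h /h]; rewrite ltxx.
have Eub : has_ubound [set t : R | 0 <= t <= 1 /\ lo t w = fset0].
  by exists 1 => t [/andP[]].
have lower : c%:R / (4 ^ k)%:R <= first_point w.
  apply: ub_le_sup => //; case: c ck hc => [|c] ck hc; first by rewrite mul0r.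
  split; last by apply/eqP; rewrite -[_ / _]/(grid_point k c) hc.
  by rewrite divr_ge0//= ler_pdivrMr// mul1r ler_nat.
have upper : first_point w <= c%:R / (4 ^ k)%:R + (4 ^ k)%:R^-1.
  apply: ge_sup; first by exists 0.
  move=> t [/andP[_ t1] tw].
  rewrite -[X in _ + X]mul1r -mulrDl natr1.
  have [cL|cL] := ltnP c (4 ^ k).
    rewrite leNgt; apply/negP => ct; have := hc _ cL; rewrite ltnn => /eqP; apply.
    exact: lo_le0 (ltW ct) tw.
  by rewrite (le_trans t1)// ler_pdivlMr// mul1r ler_nat (leq_trans cL).
by rewrite ler_distl; apply/andP; split; rewrite ?lerBlDr; lra.
Qed.

Lemma height_ge0 k w : 0 <= height k w.
Proof. by rewrite divr_ge0. Qed.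

Lemma heightB k m w : `|height k w - height m w| <= (4 ^ k)%:R^-1 + (4 ^ m)%:R^-1.
Proof.
have h1 := height_first_point k w; have h2 := height_first_point m w.
rewrite -(subrKA (first_point w)) (le_trans (ler_normD _ _))// lerD//.
by rewrite distrC.
Qed.

Lemma inv4_lt (e : R) : 0 < e -> exists N, forall n, (N <= n)%N -> (4 ^ n)%:R^-1 < e.
Proof.
move=> /natSinv_lt[N hN]; exists N => n /hN; apply: le_lt_trans.
by rewrite lef_pV2 ?posrE ?ltr0n ?expn_gt0// ler_nat ltn_expl.
Qed.

Lemma real_complex_nat (n : nat) : (n%:R : R)%:C = n%:R.
Proof. exact: (rmorph_nat (real_complex R)). Qed.

Definition stair k : bop V :=
  ((4 ^ k)%:R^-1 : R)%:C *: \sum_(j < 4 ^ k) emptyp (grid_point k j).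

Lemma bop_sumE (n : nat) (f : nat -> bop V) v w :
  (\sum_(j < n) f j : bop V) v w = \sum_(j < n) f j v w.
Proof.
elim: n => [|n ih]; first by rewrite !big_ord0.
have -> : \sum_(j < n.+1) f j = \sum_(j < n) f j + f n :> bop V.
  by rewrite big_ord_recr.
by rewrite bopD fsvecD ih [RHS]big_ord_recr.
Qed.

Lemma emptypE t v w : emptyp t v w = (lo t w == fset0)%:R * v w.
Proof.
rewrite munitE lo0; case: eqP => [h|_]; last by rewrite mul0r.
by rewrite mul1r splice_lo// lo0.
Qed.

Lemma stairE k v w : stair k v w = (height k w)%:C * v w.
Proof.
rewrite bopZ fsvecZ (bop_sumE _ (fun j => emptyp (grid_point k j))).
under eq_bigr do rewrite emptypE.
rewrite -mulr_suml mulrA; congr (_ * _).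
rewrite -natr_sum /height rmorphM [RHS]mulrC; congr (_ * _).
exact/esym/real_complex_nat.
Qed.

Lemma stair_in k : carrier grid_subalgebra (stair k).
Proof.
by apply: (@in_grid_subalgebra k); apply/spanZ/span_sum => j _; exact: emptyp_in.
Qed.

Lemma stair_star k : pstar (stair k) = stair k.
Proof.
rewrite pstarZ pstar_sum; congr (_ *: _); first exact: conjc_real.
by apply: eq_bigr => j _; exact: emptyp_star.
Qed.

Lemma stairB k m : pnorm (stair k - stair m) <= (4 ^ k)%:R^-1 + (4 ^ m)%:R^-1.
Proof.
apply: (@opnorm_diag _ _ _ (fun w => (height k w - height m w)%:C)).
- by rewrite addr_ge0// invr_ge0.
- move=> v w; rewrite bopB fsvecB !stairE.
  by rewrite -mulrBl -rmorphB.
- by move=> w; rewrite /= expr0n/= addr0 sqrtr_sqr heightB.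
Qed.

Lemma stair_cauchy : stair \in cauchy_in grid_subalgebra.
Proof.
apply/asboolP; split; first exact: stair_in.
move=> e e0; have [N hN] := inv4_lt (divr_gt0 e0 (ltr0Sn R 1)).
exists N => m n /hN hm /hN hn; rewrite (le_lt_trans (stairB _ _))//.
by rewrite [e]splitr ltrD.
Qed.

Definition stair_seq : cseq grid_subalgebra := CSeq stair_cauchy.

Lemma stair_ge1 k : 1 <= pnorm (stair k).
Proof.
have h0 : height k fset0 = 1.
  have hc j : (j < 4 ^ k)%N -> (lo (grid_point k j) fset0 == fset0) = (j < 4 ^ k)%N.
    by move=> ->; rewrite lo0 eqxx.
  by rewrite (heightE (leqnn _) hc) divff// pnatr_eq0 expn_eq0.
pose d : V := fsdelta fset0.
have sd : stair k d = d.
  apply/fsvec_eqP => w; rewrite stairE /=.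
  by have [->|_] := eqVneq w fset0; rewrite ?h0 ?mulr1// mulr0.
have d0 : 0 < vnorm d.
  rewrite lt_def vnorm_ge0 andbT.
  by apply: contra_neq (fsdelta_neq0 _); exact: vnorm_eq0.
by have := opnormP (stair k) d; rewrite sd -{1}[vnorm d]mul1r ler_pM2r.
Qed.

Lemma nonneg_gap (l : R[i]) : ~~ (0 <= l) ->
  exists2 d : R, 0 < d & forall s : R, 0 <= s -> d <= normc (l - s%:C).
Proof.
case: l => a b l0; have [b0|b0] := eqVneq b 0.
  move: l0; rewrite b0 lecE/= eqxx/= -ltNge => a0.
  exists (- a); first by rewrite oppr_gt0.
  move=> s s0; have [h _] := normc_ge_parts (a - s) (0 - 0).
  rewrite (le_trans _ h)// ler0_norm; last by rewrite subr_le0 (le_trans (ltW a0)).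
  by rewrite opprB lerBrDr addrC subrr.
exists `|b|; first by rewrite normr_gt0.
by move=> s _; have [_] := normc_ge_parts (a - s) (b - 0); rewrite {1}subr0.
Qed.

(** The inverse of l - stair k, written by summation by parts as a combination of
the projections emptyp. *)
Definition resolvent (l : R[i]) k : bop V :=
  let f j := (l - (j%:R / (4 ^ k)%:R : R)%:C)^-1 in
  (f 0%N)%:A + \sum_(j < 4 ^ k) (f j.+1 - f j) *: emptyp (grid_point k j).

Lemma resolventE l k v w : resolvent l k v w = (l - (height k w)%:C)^-1 * v w.
Proof.
have [c ck hc] := lo_threshold k w; rewrite (heightE ck hc) /resolvent.
set f := fun j : nat => (l - (j%:R / (4 ^ k)%:R : R)%:C)^-1.
rewrite bopD fsvecD bopZ fsvecZ bop1E.
rewrite (bop_sumE _ (fun j => (f j.+1 - f j) *: emptyp (grid_point k j))).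
rewrite (eq_bigr (fun j : 'I_(4 ^ k) => ((f j.+1 - f j) *+ (j < c)%N) * v w)).
  by rewrite -mulr_suml sum_threshold// -mulrDl addrC subrK.
move=> j _; rewrite bopZ fsvecZ emptypE hc//.
by rewrite mulrA mulr_natr.
Qed.

Lemma one_in k : lin_span (units_of (grid k)) (1 : bop V).
Proof.
by rewrite -(munit0 fset0 fset0); apply: munit_in; rewrite ?fsub0set ?fset1U1.
Qed.

(** 1 / (l - s) is Lipschitz on the nonnegative reals s, with constant 1 / d^2
where d is the gap between l and them. *)
Lemma resolvent_cauchy l : ~~ (0 <= l) -> resolvent l \in cauchy_in grid_subalgebra.
Proof.
move=> /nonneg_gap[d d0 hd]; apply/asboolP; split.
  move=> k; apply: (@in_grid_subalgebra k); apply: spanD; first exact/spanZ/one_in.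
  by apply: span_sum => j _; apply/spanZ/emptyp_in.
have lh0 k w : l - (height k w)%:C != 0.
  apply/eqP => e; have := hd _ (height_ge0 k w); rewrite e normc0.
  by rewrite leNgt d0.
have bound k m : pnorm (resolvent l k - resolvent l m) <=
    ((4 ^ k)%:R^-1 + (4 ^ m)%:R^-1) / d ^+ 2.
  apply: (@opnorm_diag _ _ _
    (fun w => (l - (height k w)%:C)^-1 - (l - (height m w)%:C)^-1)).
  - by rewrite divr_ge0 ?exprn_ge0 ?ltW// addr_ge0// invr_ge0.
  - move=> v w; rewrite bopB fsvecB !resolventE.
    by rewrite -mulrBl.
  - move=> w; have -> : (l - (height k w)%:C)^-1 - (l - (height m w)%:C)^-1 =
       (height k w - height m w)%:C *
       ((l - (height k w)%:C)^-1 * (l - (height m w)%:C)^-1).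
      rewrite rmorphB.
      have := lh0 k w; have := lh0 m w.
      by move=> /= h1 h2; field; rewrite h1 h2.
    rewrite !normcM !normcV expr2 invfM.
    have -> : normc (height k w - height m w)%:C = `|height k w - height m w|.
      by rewrite /= expr0n/= addr0 sqrtr_sqr.
    rewrite ler_pM ?mulr_ge0 ?invr_ge0 ?normc_ge0// ?heightB//.
    rewrite ler_pM ?invr_ge0 ?normc_ge0//.
      by rewrite lef_pV2 ?posrE ?(lt_le_trans d0) ?hd ?height_ge0.
    by rewrite lef_pV2 ?posrE ?(lt_le_trans d0) ?hd ?height_ge0.
move=> e e0; have ed0 : 0 < e * d ^+ 2 / 2 by rewrite divr_gt0// mulr_gt0 ?exprn_gt0.
have [N hN] := inv4_lt ed0; exists N => m n /hN hm /hN hn.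
rewrite (le_lt_trans (bound _ _))// ltr_pdivrMr ?exprn_gt0//.
by rewrite [_ * _]splitr ltrD.
Qed.

Lemma resolventP l k : ~~ (0 <= l) ->
  (l%:A - stair k) * resolvent l k = 1 /\ resolvent l k * (l%:A - stair k) = 1.
Proof.
move=> /nonneg_gap[d d0 hd].
have lh0 w : l - (height k w)%:C != 0.
  apply/eqP => e; have := hd _ (height_ge0 k w); rewrite e normc0.
  by rewrite leNgt d0.
have lsE v w : (l%:A - stair k) v w = (l - (height k w)%:C) * v w.
  by rewrite bopB fsvecB bopZ fsvecZ bop1E stairE mulrBl.
split; apply: bopV_eqP => v w; rewrite bopM bop1E.
  by rewrite lsE resolventE mulrA divff ?mul1r.
by rewrite resolventE lsE mulrA mulVf ?mul1r.
Qed.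

Definition nilstair k : bop V :=
  ((4 ^ k)%:R^-1 : R)%:C *: \sum_(j < 4 ^ k) nilpart (grid_point k j).

Lemma nilstair_in k : carrier grid_subalgebra (nilstair k).
Proof.
by apply: (@in_grid_subalgebra k); apply/spanZ/span_sum => j _; exact: nilpart_in.
Qed.

Lemma nilstair_nilpotent k : exists m, nilstair k ^+ m.+1 = 0.
Proof.
have [m hm] := @sum_nilpart_nilpotent R _ (4 ^ k) (grid_point_gt0 k) (@grid_point_lt k).
by exists m; rewrite /nilstair exprZn [X in _ *: X]exprS hm mulr0 scaler0.
Qed.

Lemma stair_nilstair k : pnorm (stair k - nilstair k) <= 3 / 2 ^+ k.
Proof.
rewrite -scalerBr pnormZ /= expr0n/= addr0 sqrtr_sqr ger0_norm ?invr_ge0//.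
rewrite (le_trans (ler_wpM2l _ (opnorm_emptyp_nilpart k (grid_point_gt0 k) (@grid_point_inj k)))) ?invr_ge0//.
have -> : (4 ^ k)%:R = 2 ^+ k * 2 ^+ k :> R by rewrite -exprMn -natrM natrX.
have k0 : 2 ^+ k != 0 :> R by rewrite expf_neq0// pnatr_eq0.
by rewrite le_eqVlt; apply/orP; left; apply/eqP; field.
Qed.

End Construction.

Theorem theorem3p5 (R : realType) :
  exists A : cstarAlgType R,
    is_AF A /\ positive A `&` closure (nilpotents A) <> [set 0].
Proof.
exists (completion (@grid_subalgebra R) : cstarAlgType R); split; first exact: completion_AF.
have S1 : carrier (@grid_subalgebra R) 1 by apply: in_grid_subalgebra (one_in 0).
pose a : completion (@grid_subalgebra R) := cls stair_seq.
have apos : positive (completion (@grid_subalgebra R)) a.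
  apply: positive_cls => //; first exact: stair_star.
  move=> l l0; exists (CSeq (resolvent_cauchy l0)) => n; exact: resolventP.
have anil : closure (nilpotents (completion (@grid_subalgebra R))) a.
  have /choice[m hm] := @nilstair_nilpotent R.
  apply: (closure_nilpotents_cls (@nilstair_in R) hm) => e e0.
  have [N hN] := natSinv_lt (divr_gt0 e0 (ltr0Sn R 2)).
  exists N => n Nn; rewrite (le_trans (stair_nilstair n))//.
  have n2 : n.+1%:R <= 2 ^+ n :> R by rewrite -natrX ler_nat ltn_expl.
  rewrite (le_trans (ler_wpM2l _ (_ : _ <= n.+1%:R^-1)))//.
    by rewrite lef_pV2 ?posrE ?exprn_gt0.
  by rewrite mulrC -ler_pdivlMr// ltW// hN.
move=> e; have := @cls_neq0 _ _ _ (@stair_seq R) (@stair_ge1 R).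
have : (positive (completion (@grid_subalgebra R)) `&` closure (nilpotents (completion (@grid_subalgebra R)))) a by split.
by rewrite e => a0 /eqP; exact.
Qed.
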